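(* Let $\mathcal C$ be a coalgebra with coproduct $\Delta$ and counit $\epsilon$, let $D$ be a dense subspace of a Hilbert space $\mathsf k$, and let $\varphi:\mathcal C\to\mathcal O(\hat D)$ be a linear map. Then the coalgebraic quantum stochastic differential equation $$dk_t=k_t\star_\tau\varphi\,d\Lambda_t,\qquad k_0=\iota\circ\epsilon$$ has at most one weak solution $k\in\mathbb P(\mathcal C;\mathcal E_D)$.
   Context: Vector spaces are complex; inner products are linear in the second variable. A coalgebra is a vector space $\mathcal C$ with linear maps $\Delta:\mathcal C\to\mathcal C\odot\mathcal C$ (algebraic tensor product) and $\epsilon:\mathcal C\to\mathbb C$ satisfying coassociativity $(\mathrm{id}\otimes\Delta)\Delta=(\Delta\otimes\mathrm{id})\Delta$ and the counit property $(\mathrm{id}\otimes\epsilon)\Delta=(\epsilon\otimes\mathrm{id})\Delta=\mathrm{id}$. Sweedler notation: $\Delta a=a_{(1)}\otimes a_{(2)}$ (summation suppressed). Fock space notation: $\hat{\mathsf k}=\mathbb C\oplus\mathsf k$; $\hat c=(1,c)$ for $c\in\mathsf k$; $\hat D=\mathrm{Lin}\{\hat d:d\in D\}$; $\hat f(s)=\widehat{f(s)}$ for a $\mathsf k$-valued function $f$. $\mathcal F=\Gamma(L^2(\mathbb R_+;\mathsf k))$ is the symmetric Fock space with exponential vectors $\varepsilon(f)=\sum_{n\ge0}(n!)^{-1/2}f^{\otimes n}$. $\mathbb S_D=\mathrm{Lin}\{d\,1_{[0,s)}:d\in D,s\ge0\}$ and $\mathcal E_D=\mathrm{Lin}\{\varepsilon(f):f\in\mathbb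 S_D\}$. For an interval $J$, $\mathcal F_J=\Gamma(L^2(J;\mathsf k))$, and $\mathcal F=\mathcal F_{[0,t)}\otimes\mathcal F_{[t,\infty)}$ with $\varepsilon(f)=\varepsilon(f|_{[0,t)})\otimes\varepsilon(f|_{[t,\infty)})$. For a dense subspace $E$ of a Hilbert space, $\mathcal O(E)$ is the vector space of linear operators (into that Hilbert space) with domain $E$. A process is a family $X=(X_t)_{t\ge0}$ in $\mathcal O(\mathcal E_D)$ such that $t\mapsto X_t\xi$ is weakly measurable for all $\xi\in\mathcal E_D$, and which is adapted: for each $t$ there is an operator $X(t)$ from $\mathrm{Lin}\{\varepsilon(f|_{[0,t)}):f\in\mathbb S_D\}$ to $\mathcal F_{[0,t)}$ with $X_t\varepsilon(f)=X(t)\varepsilon(f|_{[0,t)})\otimes\varepsilon(f|_{[t,\infty)})$. $\mathbb P(\mathcal C;\mathcal E_D)$ is the space of linear maps $k$ from $\mathcal C$ into the space of processes, written $a\mapsto (k_t(a))_{t\ge0}$. For a linear map $\varphi:\mathcal C\to\mathcal O(\hat D)$, a process $k\in\mathbb P(\mathcal C;\mathcal E_D)$ is a weak solution of the coalgebraic quantum stochastic differential equation $dk_t=k_t\star_\tau\varphi\,d\Lambda_t$, $k_0=\iota\circ\epsilon$ (where $\tau$ denotes the tensor flip exchanging the order of $\hat{\mathsf k}$ and $\mathcal F$, and $\iota$ denotes ampliation $z\mapsto zI$) if for all $f,g\in\mathbb S_D$, $t\ge0$, $a\in\mathcal C$, $$\langle\varepsilon(f),(k_t(a)-\epsilon(a)I)\varepsilon(g)\rangle=\int_0^t\langle\hat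 f(s),\varphi(a_{(2)})\hat g(s)\rangle\,\langle\varepsilon(f),k_s(a_{(1)})\varepsilon(g)\rangle\,ds.$$ *)

(* Defs.v *)
(* The field of complex numbers is [R[i]] with [R : realType].  All integrals are with respect to Lebesgue measure. *)
From HB Require Import structures.
From mathcomp Require Import all_boot all_order all_algebra.
From mathcomp.real_closed Require Import complex.
From mathcomp Require Import all_classical all_reals all_analysis.

Set Implicit Arguments.
Unset Strict Implicit.
Unset Printing Implicit Defensive.

Import Order.TTheory GRing.Theory Num.Theory.
Import numFieldNormedType.Exports.

Local Open Scope classical_set_scope.
Local Open Scope ring_scope.
Local Open Scope complex_scope.

Record linspace (K : fieldType) (V : lmodType K) := Linspace {
  subspace_set :> set V ;
  subspace0 : subspace_set 0 ;
  subspaceP : forall a u v,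
    subspace_set u -> subspace_set v -> subspace_set (a *: u + v) }.

Definition subspace_pred (K : fieldType) (V : lmodType K) (E : linspace V) :
  V -> Prop := subspace_set E.
Coercion subspace_pred : linspace >-> Funclass.

Section subvec.
Context {K : fieldType} {V : lmodType K} (E : linspace V).

Definition subspace_mem : {pred V} := fun x => x \in (E : set V).

Lemma subspace_mem_closed : subsemimod_closed subspace_mem.
Proof.
have E0 := subspace0 E; have EP := @subspaceP K V E.
split; first split.
- exact: mem_set.
- move=> u v /set_mem Eu /set_mem Ev.
  by apply/mem_set; rewrite -(scale1r u); apply: EP.
- move=> a v /set_mem Ev.
  by apply/mem_set; rewrite -(addr0 (a *: v)); apply: EP.
Qed.

HB.instance Definition _ := GRing.isSubSemiModClosed.Build K V subspace_mem
  subspace_mem_closed.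

Record subvec := Subvec {
  subvec_val :> V ; subvec_valP : subvec_val \in subspace_mem }.

HB.instance Definition _ := [isSub for subvec_val].
HB.instance Definition _ := [Choice of subvec by <:].
HB.instance Definition _ := [SubChoice_isSubLmodule of subvec by <:].

Definition in_subspace x (Ex : (E : set V) x) : subvec := Subvec (mem_set Ex).

End subvec.

Section Lin.
Context {K : fieldType} {V : lmodType K} (A : set V).

Definition Lin_set : set V := [set v | exists s : seq (K * V),
  (forall p, p \in s -> A p.2) /\ v = \sum_(p <- s) p.1 *: p.2].

Lemma Lin_set0 : Lin_set 0.
Proof. by exists [::]; split => //; rewrite big_nil. Qed.

Lemma Lin_setP a u v : Lin_set u -> Lin_set v -> Lin_set (a *: u + v).
Proof.
move=> [s [As ->]] [t [At ->]].
exists ([seq (a * p.1, p.2) | p <- s] ++ t); split.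
  by move=> p; rewrite mem_cat => /orP[/mapP[q /As Aq ->]|/At].
rewrite big_cat big_map scaler_sumr; congr (_ + _).
by apply: eq_bigr => p _; rewrite scalerA.
Qed.

Definition Lin : linspace V := Linspace Lin_set0 Lin_setP.

Lemma Lin_gen v : A v -> (Lin : set V) v.
Proof.
move=> Av; exists [:: (1, v)]; split; last by rewrite big_seq1 scale1r.
by move=> p; rewrite inE => /eqP ->.
Qed.

Lemma Lin_min (E : linspace V) : A `<=` E -> Lin `<=` E.
Proof.
move=> AE _ [s [As ->]].
elim: s As => [|p s IH] As; first by rewrite big_nil; exact: subspace0.
rewrite big_cons; apply: subspaceP; first by apply/AE/As/mem_head.
by apply: IH => q qs; apply: As; rewrite inE qs orbT.
Qed.

End Lin.

Section operators.
Context {K : fieldType} {V : lmodType K} (E : linspace V).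

Lemma linear_fun0 : linear (fun _ : subvec E => 0 : V).
Proof. by move=> a u v; rewrite scaler0 addr0. Qed.

Lemma linear_funP a (f g : subvec E -> V) :
  linear f -> linear g -> linear (a *: f + g).
Proof.
move=> lf lg b u v; rewrite !fctE lf lg !scalerDr !scalerA mulrC.
by rewrite addrACA.
Qed.

(* The space O(E) of linear operators with domain [E]. *)
Definition Ops_space : linspace (subvec E -> V) :=
  @Linspace K _ [set f | linear f] linear_fun0 linear_funP.

Definition Ops := subvec Ops_space.
HB.instance Definition _ := GRing.Lmodule.on Ops.

Definition opfun (X : Ops) : subvec E -> V := subvec_val X.

Definition idop : Ops := @in_subspace K _ Ops_space (@subvec_val K V E)
  (fun a u v => erefl).

End operators.
Coercion opfun : Ops >-> Funclass.

Section tensor.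
Context {K : fieldType}.
Implicit Types U V W : lmodType K.

Definition bform U V := {bilinear U -> V -> K^o}.

Definition Bform U V (f : U -> V -> K^o)
    (fP : bilinear_for *:%R *:%R f) : bform U V :=
  HB.pack f (bilinear_isBilinear.Build K U V K^o *:%R *:%R f fP).

(* [u (x) v], as evaluation of bilinear forms at [(u, v)]. *)
Definition tensor_fun U V (u : U) (v : V) : bform U V -> K^o :=
  fun b => b u v.

(* The algebraic tensor product: since bilinear forms separate its points, it
   is the span of the elementary tensors in the dual of the space of bilinear
   forms.  Thus, for [x = sum_i u_i (x) v_i] and a bilinear form [b], the value
   [x b] is [sum_i b u_i v_i], which is how an expression written in Sweedler
   notation is evaluated. *)
Definition tensor_space U V : linspace (bform U V -> K^o) :=
  Lin [set t | exists u v, t = tensor_fun u v].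

Definition tensor U V := subvec (tensor_space U V).
HB.instance Definition _ U V := GRing.Lmodule.on (tensor U V).

Definition tensor_eval U V (x : tensor U V) : bform U V -> K^o := subvec_val x.

Lemma tensor_fun_in U V (u : U) (v : V) :
  (tensor_space U V : set _) (tensor_fun u v).
Proof. by apply: Lin_gen; exists u, v. Qed.

Definition tens U V (u : U) (v : V) : tensor U V :=
  in_subspace (tensor_fun_in u v).

Lemma tensor_evalP U V (a : K) (x y : tensor U V) (b : bform U V) :
  tensor_eval (a *: x + y) b = a *: tensor_eval x b + tensor_eval y b.
Proof. by []. Qed.

Lemma tensor_eval_lin U V (x : tensor U V) (b b1 b2 : bform U V) (a : K) :
  (forall u v, b u v = a *: b1 u v + b2 u v) ->
  tensor_eval x b = a *: tensor_eval x b1 + tensor_eval x b2.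
Proof.
move=> bE; have [s [As sE]] := set_mem (subvec_valP x).
rewrite /tensor_eval sE; elim: s As {sE} => [|p s IH] As.
  by rewrite big_nil -[LHS]/(0 : K^o) -[RHS]/(a *: (0 : K^o) + 0) scaler0 addr0.
have [u [v pE]] := As p (mem_head _ _).
have {}IH := IH (fun q qs => As q (mem_behead (s := p :: s) qs)).
rewrite big_cons pE; set t := \sum_(_ <- _) _ in IH *.
rewrite -[LHS]/(p.1 *: b u v + t b) bE IH -[X in _ = a *: X + _]/(p.1 *: b1 u v + t b1).
by rewrite -[X in _ = _ + X]/(p.1 *: b2 u v + t b2) !scalerDr !scalerA [_ * a]mulrC addrACA.
Qed.

Lemma tens_linl U V (a : K) (u u' : U) (v : V) :
  tens (a *: u + u') v = a *: tens u v + tens u' v.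
Proof.
by apply/val_inj/funext => b; rewrite /= /tensor_fun linearPl.
Qed.

Lemma tens_linr U V (a : K) (u : U) (v v' : V) :
  tens u (a *: v + v') = a *: tens u v + tens u v'.
Proof.
by apply/val_inj/funext => b; rewrite /= /tensor_fun linearPr.
Qed.

Lemma tensor_space_map U V U' V' (F : bform U' V' -> bform U V) :
  (forall u v, (tensor_space U' V' : set _) (tensor_fun u v \o F)) ->
  forall x : tensor U V, (tensor_space U' V' : set _) (tensor_eval x \o F).
Proof.
move=> FP x; have [s [As sE]] := set_mem (subvec_valP x).
rewrite /tensor_eval sE; elim: s As {sE} => [|p s IH] As.
  by rewrite big_nil; exact: (subspace0 (tensor_space U' V')).
have [u [v pE]] := As p (mem_head _ _).
rewrite big_cons pE.
apply: (@subspaceP _ _ (tensor_space U' V') p.1 (tensor_fun u v \o F)) => //.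
by apply: IH => q qs; apply: As; rewrite inE qs orbT.
Qed.

Section tensor_map.
Context {U U' V V' : lmodType K} (f : {linear U -> U'}) (g : {linear V -> V'}).

Lemma tmap_bilinear (b : bform U' V') :
  bilinear_for *:%R *:%R (fun u v => b (f u) (g v)).
Proof.
split=> [v a u u' | u a v v'] /=; rewrite linearP; first by rewrite linearPl.
by rewrite linearPr.
Qed.

Definition tmap_form (b : bform U' V') : bform U V := Bform (tmap_bilinear b).

Lemma tmap_in (x : tensor U V) :
  (tensor_space U' V' : set _) (tensor_eval x \o tmap_form).
Proof.
apply: tensor_space_map => u v.
by apply: Lin_gen; exists (f u), (g v).
Qed.

Definition tmap (x : tensor U V) : tensor U' V' := in_subspace (tmap_in x).

Lemma tmapE u v : tmap (tens u v) = tens (f u) (g v).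
Proof. exact/val_inj. Qed.

End tensor_map.

Section tensor_assoc.
Context {U V W : lmodType K}.

Lemma tassoc_bilinear1 (b : bform U (tensor V W)) (w : W) :
  bilinear_for *:%R *:%R (fun u v => b u (tens v w)).
Proof.
split=> [v a u u' | u a v v'] /=; first by rewrite linearPl.
by rewrite tens_linl linearPr.
Qed.

Lemma tassoc_bilinear2 (b : bform U (tensor V W)) :
  bilinear_for *:%R *:%R
    (fun (x : tensor U V) w =>
       tensor_eval x (Bform (tassoc_bilinear1 b w))).
Proof.
split=> [w a x x' | x a w w'] //=.
by apply: tensor_eval_lin => u v /=; rewrite tens_linr linearPr.
Qed.

Definition tassoc_form (b : bform U (tensor V W)) : bform (tensor U V) W :=
  Bform (tassoc_bilinear2 b).

Lemma tassoc_in (x : tensor (tensor U V) W) :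
  (tensor_space U (tensor V W) : set _) (tensor_eval x \o tassoc_form).
Proof.
apply: tensor_space_map => y w.
pose F (b : bform U (tensor V W)) := Bform (tassoc_bilinear1 b w).
apply: (tensor_space_map (F := F)) => u v.
by apply: Lin_gen; exists u, (tens v w).
Qed.

(* The canonical isomorphism from the tensor product of [U (x) V] and [W] to
   the tensor product of [U] and [V (x) W]. *)
Definition tassoc (x : tensor (tensor U V) W) : tensor U (tensor V W) :=
  in_subspace (tassoc_in x).

Lemma tassocE u v w : tassoc (tens (tens u v) w) = tens u (tens v w).
Proof. exact/val_inj. Qed.

End tensor_assoc.

End tensor.
Coercion tensor_eval : tensor >-> Funclass.

(* The canonical identifications of [C] with [C (x) K] and [K (x) C] are
   [c |-> c (x) 1] and [c |-> 1 (x) c]. *)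
HB.mixin Record isCoalgebra (K : fieldType) C of GRing.Lmodule K C := {
  comul : {linear C -> tensor C C} ;
  counit : {linear C -> K^o} ;
  comulA : forall c : C,
    tassoc (tmap comul idfun (comul c)) = tmap idfun comul (comul c) ;
  counitr : forall c : C, tmap idfun counit (comul c) = tens c (1 : K^o) ;
  counitl : forall c : C, tmap counit idfun (comul c) = tens (1 : K^o) c }.

#[short(type="coalgType")]
HB.structure Definition Coalgebra (K : fieldType) :=
  {C of GRing.Lmodule K C & isCoalgebra K C}.

(* The inner product is linear in the second variable. *)
HB.mixin Record isHilbert (R : realType) H of CompleteNormedModule R[i] H := {
  inner : H -> H -> R[i] ;
  inner_linear : forall u, linear (inner u : H -> R[i]^o) ;
  inner_conj : forall u v, inner v u = (inner u v)^* ;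
  inner_norm : forall u, inner u u = `|u| ^+ 2 }.

#[short(type="hilbertType")]
HB.structure Definition Hilbert (R : realType) :=
  {H of CompleteNormedModule R[i] H & isHilbert R H}.


Section integrals.
Context {R : realType}.
Local Notation mu := (@lebesgue_measure R).

Definition cmeasurable (J : set R) (h : R -> R[i]) : Prop :=
  measurable_fun J (fun s => complex.Re (h s)) /\
  measurable_fun J (fun s => complex.Im (h s)).

Definition cintegrable (J : set R) (h : R -> R[i]) : Prop :=
  mu.-integrable J (fun s => (complex.Re (h s))%:E) /\
  mu.-integrable J (fun s => (complex.Im (h s))%:E).

Definition cintegral (J : set R) (h : R -> R[i]) : R[i] :=
  (\int[mu]_(s in J) complex.Re (h s))%R +i*
  (\int[mu]_(s in J) complex.Im (h s))%R.

End integrals.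

Section L2.
Context {R : realType} {k : hilbertType R}.
Local Notation mu := (@lebesgue_measure R).

Definition simple_fun (s : R -> k) : Prop :=
  finite_set (range s) /\ forall y, measurable (s @^-1` [set y]).

Definition strongly_measurable (J : set R) (f : R -> k) : Prop :=
  exists s : (R -> k)^nat, (forall n, simple_fun (s n)) /\
    forall x, J x -> s n x @[n --> \oo] --> f x.

(* Elements of L^2(J; k) are represented by functions on the line whose values
   outside [J] are irrelevant, so that [f] also represents its restrictions to
   smaller intervals.  No quotient is taken: [inner_L2] is only a semi-inner
   product, and what is built from it identifies functions which are almost
   everywhere equal on [J]. *)
Definition L2 (J : set R) (f : R -> k) : Prop :=
  strongly_measurable J f /\
  (\int[mu]_(s in J) (complex.Re (inner (f s) (f s)))%:E < +oo)%E.

Definition inner_L2 (J : set R) (f g : R -> k) : R[i] :=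
  cintegral J (fun s => inner (f s) (g s)).

End L2.

Section fock.
Context {R : realType} (k : hilbertType R).

(* The symmetric Fock space over L^2(J; k), up to unitary equivalence: a Hilbert
   space with vectors [fpow n f] standing for the n-th tensor power of [f], whose
   inner products are those of the direct sum of the tensor powers of L^2(J; k)
   and whose closed linear span (in degree n, the n-th symmetric tensor power) is
   the whole space. *)
Record fock (J : interval R) := Fock {
  fock_space :> hilbertType R ;
  fpow : nat -> (R -> k) -> fock_space ;
  fpow_inner : forall m n f g, L2 [set` J] f -> L2 [set` J] g ->
    inner (fpow m f) (fpow n g) =
    if m == n then inner_L2 [set` J] f g ^+ n else 0 ;
  fpow_total : dense (Lin [set x | exists n f, L2 [set` J] f /\ x = fpow n f]) }.

(* The exponential vector of the restriction of [f] to [J]. *)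
Definition expv J (F : fock J) (f : R -> k) : F :=
  limn (series (fun n => ((Num.sqrt (n`!%:R : R))^-1)%:C *: fpow F n f)).

(* [H] as the Hilbert space tensor product of [H1] and [H2]. *)
Record hilbert_tensor (H1 H2 H : hilbertType R) := HilbertTensor {
  htens :> {bilinear H1 -> H2 -> H} ;
  htens_inner : forall u1 v1 u2 v2,
    inner (htens u1 u2) (htens v1 v2) = inner u1 v1 * inner u2 v2 ;
  htens_total : dense (Lin [set x | exists u1 u2, x = htens u1 u2]) }.

Record fock_family := FockFamily {
  fock_on :> forall J : interval R, fock J ;
  fock_split : forall t : R, 0 <= t ->
    hilbert_tensor (fock_on `[0, t[) (fock_on `[t, +oo[) (fock_on `[0, +oo[) ;
  fock_splitE : forall (t : R) (t0 : 0 <= t) (f : R -> k), L2 `[0, +oo[ f ->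
    fock_split t0 (expv (fock_on `[0, t[) f) (expv (fock_on `[t, +oo[) f) =
    expv (fock_on `[0, +oo[) f }.

End fock.

Section khat.
Context {R : realType} (k : hilbertType R).

Definition khat := (R[i]^o * k)%type.

(* The inner product of the Hilbert space direct sum; the norm which [khat]
   inherits as a product is not used. *)
Definition inner_hat (u v : khat) : R[i] := (u.1)^* * v.1 + inner u.2 v.2.

Definition hat (c : k) : khat := (1, c).

End khat.

Section step_functions.
Context {R : realType} {k : hilbertType R} (D : linspace k).

Definition Dhat : linspace (khat k) := Lin [set u | exists2 d, D d & u = hat d].

(* [S_D] *)
Definition step_space : linspace (R -> k) :=
  Lin [set f | exists d s,
    [/\ D d, 0 <= s & f = fun x => if 0 <= x < s then d else 0]].

Definition steps := subvec step_space.

Definition step_fun (f : steps) : R -> k := subvec_val f.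

Lemma step_funP (f : steps) s : D (step_fun f s).
Proof.
rewrite /step_fun; have [c [Dc ->]] := set_mem (subvec_valP f).
elim: c Dc => [|p c IH] Dc; first by rewrite big_nil; exact: (subspace0 D).
rewrite big_cons; have [d [u [Dd _ pE]]] := Dc p (mem_head _ _).
rewrite pE; apply: (@subspaceP _ _ D p.1 (if 0 <= s < u then d else 0)).
  by case: ifP => // _; exact: (subspace0 D).
by apply: IH => q qc; apply: Dc; rewrite inE qc orbT.
Qed.

Definition hat_step (f : steps) (s : R) : subvec Dhat :=
  in_subspace (Lin_gen (ex_intro2 _ _ _ (step_funP f s) erefl)).

End step_functions.
Coercion step_fun : steps >-> Funclass.

Section processes.
Context {R : realType} {k : hilbertType R} (D : linspace k) (F : fock_family k).

Local Notation Fock := (F `[0, +oo[).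

(* The span of the exponential vectors of the restrictions to [J] of the step
   functions. *)
Definition exp_space (J : interval R) : linspace (F J) :=
  Lin [set x | exists2 f, step_space D f & x = expv (F J) f].

Definition exp_vec (J : interval R) (f : steps D) :
    subvec (exp_space J) :=
  in_subspace (Lin_gen (ex_intro2 _ _ (f : R -> k) (set_mem (subvec_valP f)) erefl)).

Definition E_D : linspace Fock := exp_space `[0, +oo[.

Definition weakly_measurable (X : R -> Ops E_D) : Prop :=
  forall (eta : Fock) (xi : subvec E_D),
    cmeasurable `[0, +oo[ (fun t => inner eta (X t xi)).

Definition adapted (X : R -> Ops E_D) : Prop :=
  forall (t : R) (t0 : 0 <= t),
  exists Xt : Ops (exp_space `[0, t[), forall f : steps D,
    X t (exp_vec `[0, +oo[ f) =
    fock_split F t0 (Xt (exp_vec `[0, t[ f)) (expv (F `[t, +oo[) f).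

(* A process is indexed by [t >= 0]; the values at negative times are
   irrelevant. *)
Definition process (X : R -> Ops E_D) : Prop :=
  weakly_measurable X /\ adapted X.

End processes.

Section coalgebraic_qsde.
Context {R : realType} {k : hilbertType R} (D : linspace k) (F : fock_family k).
Context (C : coalgType R[i]).

Local Notation Fock := (F `[0, +oo[).
Local Notation ED := (E_D D F).
Local Notation eps f := (exp_vec F `[0, +oo[ f).

Record coalg_process := CoalgProcess {
  coalg_process_fun :> {linear C -> (R -> Ops ED)} ;
  coalg_processP : forall a, process (coalg_process_fun a) }.

Section weak_solution.
Context (phi : {linear C -> Ops (Dhat D)}) (X : coalg_process).
Implicit Types f g : steps D.

(* [a1] and [a2] stand for the Sweedler components a_(1) and a_(2). *)
Definition qsde_fun f g (s : R) (a1 a2 : C) : R[i]^o :=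
  inner_hat (hat (f s)) (opfun (phi a2) (hat_step g s)) *
  inner (expv Fock f) (opfun (X a1 s) (eps g)).

Lemma qsde_fun_bilinear f g s : bilinear_for *:%R *:%R (qsde_fun f g s).
Proof.
have ihP u : linear (inner_hat u : khat k -> R[i]^o).
  move=> a v w; rewrite /inner_hat /= inner_linear mulrDr addrACA; congr (_ + _).
  by rewrite -[a *: v.1]/(a * v.1) mulrCA -[LHS]mulrDr.
split=> [a2 c a a' | a1 c a a']; rewrite /qsde_fun.
  have -> : opfun (X (c *: a + a') s) (eps g) =
      c *: opfun (X a s) (eps g) + opfun (X a' s) (eps g) by rewrite linearP.
  by rewrite inner_linear mulrDr -[_ *: inner _ _]/(_ * _) mulrCA.
have -> : opfun (phi (c *: a + a')) (hat_step g s) =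
  c *: opfun (phi a) (hat_step g s) + opfun (phi a') (hat_step g s) by rewrite linearP.
by rewrite ihP mulrDl -[_ *: inner_hat _ _]/(_ * _) -mulrA.
Qed.

Definition qsde_form f g s : bform C C := Bform (qsde_fun_bilinear f g s).

(* The equation presupposes that its right-hand side is integrable; the
   integral of the library is a default value otherwise. *)
Definition weak_solution : Prop :=
  forall f g (t : R) (a : C), 0 <= t ->
  let h s := tensor_eval (comul a) (qsde_form f g s) in
  cintegrable `[0, t] h /\
  inner (expv Fock f) (opfun (X a t - counit a *: idop ED) (eps g)) =
  cintegral `[0, t] h.

End weak_solution.
End coalgebraic_qsde.

(* Main.v *)
(** Let u_s(c) be the matrix element of X_s(c) - Y_s(c) between the exponential vectors of
f and g, and let psi_s(c) be that of phi(c) between the hatted values f(s) and g(s).  The weak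
equation says u_t(c) = int_0^t (u_s * psi_s)(c) ds, where * is the convolution dual to the
coproduct.  If Delta a is a sum of n elementary tensors, then (mu * nu)(a) depends on nu only
through n scalars, so the functionals mu |-> (mu * nu)(a) form a space with finitely many
generators la_p; by coassociativity the functions (u_t * la_p)(a) solve a linear system
of integral equations, whose coefficients are bounded because psi_s takes finitely many values,
hence they vanish, and so does u_t = u_t * counit at a.

It remains to see that a vector x orthogonal to all expv f, with f a D-valued step function, is
0.  The function t |-> <expv (t f), x> is a power series in t whose coefficients are multiples of
the <fpow n f, x>, so the latter vanish.  The map fpow 1 is isometric and linear on L^2, the
images of step functions are dense in its range, and fpow n is continuous for it; so x is
orthogonal to all fpow n f with f in L^2. *)

From HB Require Import structures.
Require Import Defs.
From mathcomp Require Import all_boot all_order all_algebra.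
From mathcomp.real_closed Require Import complex.
From mathcomp Require Import ring lra.
From mathcomp Require Import all_classical all_reals all_analysis measurable_realfun.

Set Implicit Arguments.
Unset Strict Implicit.
Unset Printing Implicit Defensive.

Import Order.TTheory GRing.Theory Num.Theory.
Import numFieldNormedType.Exports.

Local Open Scope classical_set_scope.
Local Open Scope ring_scope.
Local Open Scope complex_scope.

(** * Convolution of functionals on a coalgebra *)

Section tensors.
Context {K : fieldType}.
Implicit Types U V W : lmodType K.

(** The tensor product is by construction the span of the elementary tensors; absorbing the scalars
    into the left factors turns an element into an explicit Sweedler sum. *)
Lemma tensor_repr U V (x : tensor U V) :
  exists n (u : 'I_n -> U) (v : 'I_n -> V),
    forall b : bform U V, tensor_eval x b = \sum_i b (u i) (v i).
Proof.
have [s [As sE]] := set_mem (subvec_valP x).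
rewrite /tensor_eval sE {sE}; elim: s As => [|p s IH] As.
  exists 0%N, (fun=> 0), (fun=> 0) => b; rewrite big_nil big_ord0; reflexivity.
have [q qs|n [u [v xE]]] := IH; first by apply: As; rewrite inE qs orbT.
have [u0 [v0 pE]] := As p (mem_head _ _).
exists n.+1, (fun i => if unlift ord0 i is Some j then u j else p.1 *: u0),
  (fun i => if unlift ord0 i is Some j then v j else v0) => b.
have sumE : \sum_(i < n) b (u i) (v i) = \sum_(i < n)
    b (if unlift ord0 (lift ord0 i) is Some j then u j else p.1 *: u0)
      (if unlift ord0 (lift ord0 i) is Some j then v j else v0).
  by apply: eq_bigr => i _; rewrite liftK.
rewrite big_ord_recl unlift_none -sumE -xE big_cons pE linearZl; reflexivity.
Qed.

(** Packed forms carry their own bilinearity proofs, so pointwise agreement replaces equality of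
    forms. *)
Lemma eq_tensor_eval U V (x : tensor U V) (b c : bform U V) :
  (forall u v, b u v = c u v) -> tensor_eval x b = tensor_eval x c.
Proof.
by have [n [u [v xE]]] := tensor_repr x => bc; rewrite !xE; apply: eq_bigr.
Qed.

End tensors.

Lemma tmap_eval (K : fieldType) (U U' V V' : lmodType K) (f : {linear U -> U'})
    (g : {linear V -> V'}) (x : tensor U V) (b : bform U' V') :
  tensor_eval (tmap f g x) b = tensor_eval x (tmap_form f g b).
Proof. by []. Qed.

Lemma tassoc_eval (K : fieldType) (U V W : lmodType K)
    (x : tensor (tensor U V) W) (b : bform U (tensor V W)) :
  tensor_eval (tassoc x) b = tensor_eval x (tassoc_form b).
Proof. by []. Qed.

Section convolution.
Context {K : fieldType}.

Lemma tensor_form_bilinear (U V : lmodType K) (mu : {linear U -> K^o})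
    (la : {linear V -> K^o}) :
  bilinear_for *:%R *:%R (fun u v => (mu u * la v : K^o)).
Proof.
split=> [v a u u' | u a v v']; rewrite linearP.
  by rewrite mulrDl /= -mulrA.
by rewrite mulrDr /= mulrCA.
Qed.

Definition tensor_form (U V : lmodType K) mu la : bform U V :=
  Bform (tensor_form_bilinear mu la).

(** Evaluation at a fixed form as a linear functional, so that it can itself be a factor of a
    [tensor_form]. *)
Definition form_eval (U V : lmodType K) (b : bform U V) (x : tensor U V) : K^o :=
  tensor_eval x b.

Lemma form_eval_linear (U V : lmodType K) (b : bform U V) :
  linear (form_eval b).
Proof. by move=> a x y; rewrite /form_eval tensor_evalP. Qed.

HB.instance Definition _ (U V : lmodType K) (b : bform U V) :=
  GRing.isLinear.Build K (tensor U V) K^o *:%R (form_eval b) (form_eval_linear b).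

Context {C : coalgType K}.
Implicit Types mu la nu : {linear C -> K^o}.

Definition convolution mu la (c : C) : K^o :=
  tensor_eval (comul c) (tensor_form mu la).

Lemma convolution_linear mu la : linear (convolution mu la).
Proof. by move=> a u v; rewrite /convolution linearP. Qed.

HB.instance Definition _ mu la :=
  GRing.isLinear.Build K C K^o *:%R (convolution mu la) (convolution_linear mu la).

Definition conv mu la : {linear C -> K^o} := convolution mu la.

Lemma convE mu la c n (u v : 'I_n -> C) :
  (forall b : bform C C, tensor_eval (comul c) b = \sum_i b (u i) (v i)) ->
  conv mu la c = \sum_i mu (u i) * la (v i).
Proof. by move=> cE; rewrite /conv /= /convolution cE. Qed.

(** This is [counitr] evaluated at the form [mu] tensor identity. *)
Lemma conv_counit mu c : conv mu counit c = mu c.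
Proof.
pose b := tensor_form mu (idfun : {linear K^o -> K^o}).
have := congr1 (fun x => tensor_eval x b) (counitr c).
rewrite -[RHS]/(mu c * 1) mulr1 => <-.
exact: eq_tensor_eval.
Qed.

(** Coassociativity evaluated at the form [mu] tensor ([la] tensor [nu]). Only the side with
    [conv mu la] needs a second expansion, that of [comul u]. *)
Lemma convA mu la nu c : conv (conv mu la) nu c = conv mu (conv la nu) c.
Proof.
pose b2 : {linear tensor C C -> K^o} := form_eval (tensor_form la nu).
pose b := tensor_form mu b2.
have := congr1 (fun x => tensor_eval x b) (comulA c).
rewrite tassoc_eval !tmap_eval => E.
transitivity (tensor_eval (comul c) (tmap_form comul idfun (tassoc_form b))); last first.
  by rewrite E; exact: eq_tensor_eval.
apply: eq_tensor_eval => u v; rewrite /= /convolution.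
have [n [x [y uE]]] := tensor_repr (comul u).
rewrite /tassoc_form !uE /= mulr_suml; apply: eq_bigr => i _.
by rewrite -mulrA.
Qed.

End convolution.

(** Among the matrices with rows in [L], take one of maximal rank: a row of [L] outside its row
    space could be added to it and would increase the rank. *)
Lemma subspace_rows (K : fieldType) n (L : set 'rV[K]_n) :
  L 0 -> (forall a x y, L x -> L y -> L (a *: x + y)) ->
  exists B : 'M[K]_n, (forall i, L (row i B)) /\ forall x, L x -> (x <= B)%MS.
Proof.
move=> L0 LP.
have Lsub m' (A : 'M[K]_(m', n)) : (forall i, L (row i A)) ->
    forall x, (x <= A)%MS -> L x.
  move=> LA x /submxP[y ->]; rewrite mulmx_sum_row.
  by elim/big_rec: _ => // i z _ Lz; exact: LP.
pose P r := `[< exists B : 'M[K]_n, (forall i, L (row i B)) /\ \rank B = r >].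
have exP : exists r, P r.
  exists 0%N; apply/asboolP; exists 0; split; last by rewrite mxrank0.
  by move=> i; rewrite row0.
have ubP r : P r -> (r <= n)%N.
  by move=> /asboolP[B [_ <-]]; exact: rank_leq_row.
case: (ex_maxnP exP ubP) => r /asboolP[B [LB rB]] rmax.
exists B; split=> // x Lx; have [//|nle] := boolP (x <= B)%MS.
have : (B < B + x)%MS by rewrite ltmxE addsmxSl addsmx_sub submx_refl.
rewrite ltmxErank => /andP[_].
have : P (\rank (B + x)%MS).
  apply/asboolP; exists (B + x)%MS; split=> // i.
  have /sub_addsmxP[[y z] ->] : (row i (B + x)%MS <= B + x)%MS by exact: row_sub.
  rewrite (mx11_scalar z) mul_scalar_mx addrC.
  by apply: LP => //; apply: (Lsub _ B LB); exact: submxMl.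
by move=> /rmax; rewrite rB leqNgt => /negP.
Qed.

(* The functionals [mu |-> conv mu (la p) a] play the role of a basis of a
   finite-dimensional subcomodule containing [a]. *)
Lemma conv_finite (K : fieldType) (C : coalgType K) (a : C) :
  exists n (la : 'I_n -> {linear C -> K^o}), forall nu : {linear C -> K^o},
    exists x : 'I_n -> K, forall mu : {linear C -> K^o},
      conv mu nu a = \sum_p x p * conv mu (la p) a.
Proof.
have [n [u [v aE]]] := tensor_repr (comul a).
(* The value [conv mu nu a] sees [nu] only through the row of its values at the [v i]; these rows
   form a subspace of a finite-dimensional space. *)
pose L : set 'rV[K]_n :=
  [set y | exists nu : {linear C -> K^o}, forall i, y 0 i = nu (v i)].
have L0 : L 0 by exists (\0 : C -> K^o) => i; rewrite mxE.
have LP c x y : L x -> L y -> L (c *: x + y).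
  by move=> [nu xE] [nu' yE]; exists ((c \*: nu) \+ nu') => i; rewrite !mxE xE yE.
have [B [LB LsubB]] := subspace_rows L0 LP.
have [la laE] := choice LB; move: LsubB => /= LsubB; exists n, la => nu.
have /submxP[y yE] : (\row_i (nu (v i) : K) <= B)%MS.
  by apply: LsubB; exists nu => i; rewrite mxE.
have nuE i : nu (v i) = \sum_p y 0 p * la p (v i).
  move/rowP: yE => /(_ i); rewrite !mxE => ->.
  by apply: eq_bigr => p _; rewrite -laE mxE.
(* The coordinates of the row of [nu] along the rows of [B] do not involve [mu], so they serve for
   all [mu] at once. *)
exists (y 0) => mu; rewrite (convE _ _ aE).
transitivity (\sum_i \sum_p mu (u i) * (y 0 p * la p (v i))).
  by apply: eq_bigr => i _; rewrite nuE mulr_sumr.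
rewrite exchange_big; apply: eq_bigr => p _.
by rewrite (convE _ _ aE) mulr_sumr; apply: eq_bigr => i _; rewrite mulrCA.
Qed.

(** * A Gronwall argument *)

(** For [x > 0], an integer [m] above [K / x] already gives [2 ^+ m > K / x]. This concludes both
    the halving in [gronwall] and the dyadic limit in [fpow_orthogonal]. *)
Lemma le0_pow2 {R : realType} (x K : R) :
  (forall m, x <= K / 2 ^+ m) -> x <= 0.
Proof.
move=> xK; rewrite leNgt; apply/negP => x0.
pose m := (Num.trunc (K / x)).+1.
have Km : K / x < m%:R by apply: Num.Theory.truncnS_gt.
have m2 : m%:R < 2 ^+ m :> R by rewrite -natrX ltr_nat ltn_expl.
have := xK m; rewrite leNgt ltr_pdivrMr ?exprn_gt0// => /negP; apply.
by rewrite mulrC -ltr_pdivrMr// (lt_trans Km).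
Qed.

Section gronwall.
Context {R : realType}.
Local Notation mu := (@lebesgue_measure R).

(** A real-valued submultiplicative norm on the complex numbers, adapted to integrals that are
    defined by real and imaginary parts. *)
Definition norm1 (z : R[i]) : R := `|complex.Re z| + `|complex.Im z|.

Lemma norm1_ge0 z : 0 <= norm1 z.
Proof. exact: addr_ge0. Qed.

Lemma norm1_0 : norm1 0 = 0.
Proof. by rewrite /norm1 normr0 addr0. Qed.

Lemma norm1_le0 z : norm1 z <= 0 -> z = 0.
Proof.
case: z => a b; rewrite /norm1 /= => ab.
have a0 : `|a| = 0 by apply/eqP; rewrite eq_le normr_ge0 andbT; have := normr_ge0 b; lra.
have b0 : `|b| = 0 by apply/eqP; rewrite eq_le normr_ge0 andbT; have := normr_ge0 a; lra.
by rewrite (normr0_eq0 a0) (normr0_eq0 b0).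
Qed.

Lemma norm1D x y : norm1 (x + y) <= norm1 x + norm1 y.
Proof.
case: x y => [a b] [c d]; rewrite /norm1 /=.
by have := ler_normD a c; have := ler_normD b d; lra.
Qed.

Lemma norm1M x y : norm1 (x * y) <= norm1 x * norm1 y.
Proof.
case: x y => [a b] [c d]; rewrite /norm1 /= mulrDl !mulrDr -!normrM.
have := ler_normB (a * c) (b * d); have := ler_normD (a * d) (b * c); lra.
Qed.

Lemma norm1_sum n (z : 'I_n -> R[i]) : norm1 (\sum_i z i) <= \sum_i norm1 (z i).
Proof.
elim/big_rec2: _ => [|i x y _ IH]; first by rewrite norm1_0.
by apply: (le_trans (norm1D _ _)); rewrite lerD2l.
Qed.

(** The difference is the integral over []s, t]], an interval of measure [t - s]. *)
Lemma Rintegral_itv_lip (g : R -> R) (s t B : R) : 0 <= s <= t ->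
  mu.-integrable `[0, t] (EFin \o g) ->
  (forall x, s < x <= t -> `|g x| <= B) ->
  `|\int[mu]_(x in `[0, t]) g x - \int[mu]_(x in `[0, s]) g x| <= B * (t - s).
Proof.
move=> /andP[s0 st] gi gB.
rewrite (@Rintegral_itvB _ g (BLeft 0) (BRight t) s)// ?bnd_simp//.
have gi' : mu.-integrable `]s, t] (EFin \o g).
  by apply: integrableS gi => //; apply: subset_itvr; rewrite bnd_simp.
apply: (le_trans (le_normr_Rintegral _ gi')) => //.
have -> : B * (t - s) = \int[mu]_(x in `]s, t]) B.
  rewrite Rintegral_cst//= lebesgue_measure_itv/= lte_fin.
  by case: ltgtP st => // -> _; rewrite subrr.
apply: le_Rintegral => //.
- exact: (integrable_norm gi').
- apply/integrableP; split; first exact: measurable_cst.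
  rewrite integral_cst//= lebesgue_measure_itv/= lte_fin.
  by case: ifP => _; rewrite ?mule0 ?ltry.
Qed.

Lemma cintegral_lip (h : R -> R[i]) (s t B : R) : 0 <= s <= t ->
  cintegrable `[0, t] h ->
  (forall x, s < x <= t -> norm1 (h x) <= B) ->
  norm1 (cintegral `[0, t] h - cintegral `[0, s] h) <= (B + B) * (t - s).
Proof.
move=> st [hr hi] hB; rewrite /norm1 /= mulrDl; apply: lerD.
  apply: Rintegral_itv_lip => // x /hB; apply: le_trans.
  by rewrite lerDl.
apply: Rintegral_itv_lip => // x /hB; apply: le_trans.
by rewrite lerDr.
Qed.

Lemma Rintegral_itv_bound (g : R -> R) (T : R) :
  mu.-integrable `[0, T] (EFin \o g) ->
  exists K, forall t, 0 <= t <= T -> `|\int[mu]_(x in `[0, t]) g x| <= K.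
Proof.
move=> gi; exists (\int[mu]_(x in `[0, T]) `|g x|) => t /andP[t0 tT].
have gi' : mu.-integrable `[0, t] (EFin \o g).
  by apply: integrableS gi => //; apply: subset_itvl; rewrite bnd_simp.
apply: (le_trans (le_normr_Rintegral _ gi')) => //.
rewrite -subr_ge0 (@Rintegral_itvB _ (fun x => `|g x|) (BLeft 0) (BRight T) t)// ?bnd_simp//.
- exact: Rintegral_ge0.
- exact: (integrable_norm gi).
Qed.

(** Integrability alone bounds the primitive, by the integrals of the moduli of the two parts. This
    starts the iteration in [gronwall], where [v] is not known to be bounded beforehand. *)
Lemma cintegral_bound (h : R -> R[i]) (T : R) : cintegrable `[0, T] h ->
  exists K, forall t, 0 <= t <= T -> norm1 (cintegral `[0, t] h) <= K.
Proof.
move=> [/Rintegral_itv_bound[K1 K1P] /Rintegral_itv_bound[K2 K2P]].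
by exists (K1 + K2) => t tT; apply: lerD; [exact: K1P|exact: K2P].
Qed.

(** The proof advances by time steps of a fixed length [d]: once [v] vanishes up to [s], any bound
    for it up to [s + d] can be halved again and again, so [v] vanishes there too. *)
Lemma gronwall n (v h : 'I_n -> R -> R[i]) (c : 'I_n -> 'I_n -> R -> R[i]) (M : R) :
  (forall p t, 0 <= t -> cintegrable `[0, t] (h p)) ->
  (forall p t, 0 <= t -> v p t = cintegral `[0, t] (h p)) ->
  (forall p s, 0 <= s -> h p s = \sum_q c p q s * v q s) ->
  (forall p q s, 0 <= s -> norm1 (c p q s) <= M) ->
  forall p t, 0 <= t -> v p t = 0.
Proof.
move=> hi vE hE cM.
(* On an interval of length [d], a bound [B] for [v] improves to [B / 2]. *)
pose A := n%:R * `|M|; have A0 : 0 <= A by rewrite mulr_ge0.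
(* Halving requires [(A * B + A * B) * d <= B / 2], that is [4 * (A * d) <= 1]; the summand 1 keeps
   the denominator positive when [A = 0]. *)
pose d := (4 * A + 1)^-1; have d0 : 0 < d by rewrite invr_gt0; lra.
have Ad : 4 * (A * d) <= 1.
  by rewrite mulrA /d ler_pdivrMr; lra.
have step (s : R) : 0 <= s -> (forall p t, 0 <= t <= s -> v p t = 0) ->
    forall p t, 0 <= t <= s + d -> v p t = 0.
  move=> s0 vs.
  have [K KP] : exists K, forall p t, 0 <= t <= s + d -> norm1 (v p t) <= K.
    have /choice[K KP] p : exists K, forall t, 0 <= t <= s + d -> norm1 (v p t) <= K.
      have [|K KP] := cintegral_bound (hi p (s + d) _); first by rewrite addr_ge0// ltW.
      by exists K => t /[dup] /andP[t0 _] /KP; rewrite vE.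
    exists (\sum_p `|K p|) => p t td; apply: (le_trans (KP p t td)).
    rewrite (bigD1 p)//= (le_trans (ler_norm _))// lerDl.
    exact: sumr_ge0.
  have half B : (forall p t, 0 <= t <= s + d -> norm1 (v p t) <= B) ->
      forall p t, 0 <= t <= s + d -> norm1 (v p t) <= B / 2.
    move=> BP p t /andP[t0 td].
    have B0 : 0 <= B.
      by apply: le_trans (norm1_ge0 _) (BP p t _); rewrite t0.
    have [ts|st] := leP t s.
      by rewrite vs ?t0// norm1_0 divr_ge0.
    have -> : v p t = cintegral `[0, t] (h p) - cintegral `[0, s] (h p).
      by rewrite -!vE// (vs p s) ?subr0// lexx s0.
    have hB x : s < x <= t -> norm1 (h p x) <= A * B.
      move=> /andP[sx xt]; have x0 : 0 <= x by rewrite (le_trans s0)// ltW.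
      rewrite hE//; apply: (le_trans (norm1_sum _)).
      have -> : A * B = \sum_(q < n) (`|M| * B).
        by rewrite sumr_const card_ord /A -mulrA mulr_natl.
      apply: ler_sum => q _; apply: (le_trans (norm1M _ _)).
      apply: ler_pM; rewrite ?norm1_ge0//.
        by rewrite (le_trans (cM _ _ _ _))// ler_norm.
      by apply: BP; rewrite x0 (le_trans xt).
    apply: (le_trans (cintegral_lip _ (hi p t t0) hB)); first by rewrite s0 ltW.
    have : (A * B + A * B) * (t - s) <= (A * B + A * B) * d.
      by apply: ler_wpM2l; [rewrite addr_ge0// mulr_ge0|lra].
    by nra.
  move=> p t td; apply/norm1_le0/(@le0_pow2 _ _ K) => m.
  elim: m p t td => [|m IH] p t td; first by rewrite expr0 divr1 KP.
  by rewrite exprSr invfM mulrA; apply: half.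
have steps j : forall p t, 0 <= t <= j%:R * d -> v p t = 0.
  elim: j => [|j IH] p t.
    (* Here [t = 0], and the integral is over a single point. *)
    rewrite mul0r => /le_anti <-; rewrite vE// /cintegral set_itv1.
    by rewrite !Rintegral_set1.
  rewrite mulrSr mulrDl mul1r; apply: step IH _ _.
  by rewrite mulr_ge0// ltW.
move=> p t t0; apply: (steps (Num.trunc (t / d)).+1).
by rewrite t0 -ler_pdivrMr// ltW// truncnS_gt.
Qed.

End gronwall.

(** * Hilbert spaces *)

Section hilbert.
Context {R : realType} {H : hilbertType R}.
Implicit Types (u v w : H) (a : R[i]).

Lemma innerDr u v w : inner u (v + w) = inner u v + inner u w.
Proof. by have := inner_linear u 1 v w; rewrite !scale1r. Qed.

Lemma inner0r u : inner u 0 = 0.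
Proof.
by have := innerDr u 0 0; rewrite addr0 => /eqP; rewrite -subr_eq subrr => /eqP.
Qed.

Lemma innerZr a u v : inner u (a *: v) = a * inner u v.
Proof. by have := inner_linear u a v 0; rewrite !addr0 inner0r addr0. Qed.

Lemma innerDl u v w : inner (u + v) w = inner u w + inner v w.
Proof. by rewrite ![inner _ w]inner_conj innerDr rmorphD. Qed.

Lemma innerZl a u v : inner (a *: u) v = a^* * inner u v.
Proof. by rewrite ![inner _ v]inner_conj innerZr rmorphM. Qed.

Lemma innerNr u v : inner u (- v) = - inner u v.
Proof. by rewrite -scaleN1r innerZr mulN1r. Qed.

Lemma innerNl u v : inner (- u) v = - inner u v.
Proof. by rewrite inner_conj innerNr rmorphN /= -inner_conj. Qed.

Lemma inner_sumr u I (r : seq I) (F : I -> H) :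
  inner u (\sum_(i <- r) F i) = \sum_(i <- r) inner u (F i).
Proof. by elim/big_ind2: _ => [|? ? ? ? <- <-|//]; rewrite ?inner0r ?innerDr. Qed.

(** The norm of [H] takes values in [R[i]]; by [normE] its real part loses nothing and belongs to a
    totally ordered field. *)
Definition nrm u : R := complex.Re `|u|.

Lemma normE u : `|u| = (nrm u)%:C.
Proof. by rewrite /nrm RRe_real// ger0_real. Qed.

Lemma nrm_ge0 u : 0 <= nrm u.
Proof. by have := normr_ge0 u; rewrite normE ler0c. Qed.

Lemma innerE u : inner u u = (nrm u ^+ 2)%:C.
Proof. by rewrite inner_norm normE rmorphXn. Qed.

Lemma nrm0 : nrm 0 = 0. Proof. by rewrite /nrm normr0. Qed.

Lemma nrm_eq0 u : nrm u = 0 -> u = 0.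
Proof. by move=> u0; apply/normr0_eq0; rewrite normE u0. Qed.

Lemma nrmD u v : nrm (u + v) <= nrm u + nrm v.
Proof. by have := ler_normD u v; rewrite !normE -rmorphD lecR. Qed.

Lemma nrmN u : nrm (- u) = nrm u. Proof. by rewrite /nrm normrN. Qed.

Lemma nrmBC u v : nrm (u - v) = nrm (v - u).
Proof. by rewrite -nrmN opprB. Qed.

Lemma nrmZ_norm a u : nrm (a *: u) = complex.Re `|a| * nrm u.
Proof.
by apply: complexI; rewrite rmorphM/= -!normE normrZ; congr (_ * _).
Qed.

Lemma nrmZ (t : R) u : nrm (t%:C *: u) = `|t| * nrm u.
Proof. by rewrite nrmZ_norm normc_def/= expr0n addr0 sqrtr_sqr. Qed.

Lemma sqr_nrm u : nrm u ^+ 2 = complex.Re (inner u u).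
Proof. by rewrite innerE. Qed.

Lemma sqr_nrmD u v :
  nrm (u + v) ^+ 2 = nrm u ^+ 2 + 2 * complex.Re (inner u v) + nrm v ^+ 2.
Proof.
rewrite !sqr_nrm innerDl !innerDr [inner v u]inner_conj.
case: (inner u v) (inner u u) (inner v v) => [a b] [c d] [e f] /=; ring.
Qed.

(** Cauchy-Schwarz for the real part: subtract from [u] its projection on [v] for the real inner
    product, and use that the squared norm of the rest is nonnegative. *)
Lemma Re_inner_le u v : `|complex.Re (inner u v)| <= nrm u * nrm v.
Proof.
set r := complex.Re _.
have [v0|v0] := eqVneq (nrm v) 0.
  by rewrite /r (nrm_eq0 v0) inner0r normr0 nrm0 mulr0.
have vp : 0 < nrm v by rewrite lt_neqAle eq_sym v0 nrm_ge0.
rewrite -(@ler_pXn2r _ 2)// ?nnegrE ?mulr_ge0 ?nrm_ge0//.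
rewrite real_normK ?num_real// exprMn.
have := sqr_ge0 (nrm (u + (- (r / nrm v ^+ 2))%:C *: v)).
rewrite sqr_nrmD nrmZ exprMn real_normK ?num_real// innerZr.
have -> : complex.Re ((- (r / nrm v ^+ 2))%:C * inner u v) = - (r / nrm v ^+ 2) * r.
  by rewrite /r; case: (inner u v) => a b /=; ring.
have -> : nrm u ^+ 2 + 2 * (- (r / nrm v ^+ 2) * r) + (- (r / nrm v ^+ 2)) ^+ 2 * nrm v ^+ 2
   = (nrm u ^+ 2 * nrm v ^+ 2 - r ^+ 2) / nrm v ^+ 2 by field.
by rewrite pmulr_lge0 ?invr_gt0 ?exprn_gt0// subr_ge0.
Qed.

(** Up to sign the imaginary part is the real part of [inner u ('i *: v)], so [Re_inner_le] applies
    twice; hence the factor 2. *)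
Lemma norm1_inner u v : norm1 (inner u v) <= 2 * (nrm u * nrm v).
Proof.
rewrite mulr2n mulrDl mul1r; apply: lerD; first exact: Re_inner_le.
have -> : `|complex.Im (inner u v)| = `|complex.Re (inner u ('i *: v))|.
  by rewrite innerZr; case: (inner u v) => a b /=; rewrite mul0r mul1r sub0r normrN.
apply: (le_trans (Re_inner_le _ _)).
have -> // : nrm ('i *: v) = nrm v.
rewrite /nrm normrZ normc_def /= expr0n add0r expr1n sqrtr1.
by rewrite mul1r.
Qed.

Lemma inner_eq0 u : inner u u = 0 -> u = 0.
Proof.
rewrite innerE => /complexI /eqP; rewrite sqrf_eq0 => /eqP; exact: nrm_eq0.
Qed.

Lemma dense_nrm (A : set H) : dense A ->
  forall u (e : R), 0 < e -> exists2 v, A v & nrm (u - v) < e.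
Proof.
move=> dA u e e0.
have e0c : 0 < e%:C :> R[i] by rewrite ltcR.
have [|v [vu Av]] := dA (interior (ball u e%:C)) _ (@open_interior _ _).
  exists u; apply: nbhsx_ballx e0c.
exists v => //; have := interior_subset vu.
by rewrite -ball_normE /= normE ltcR.
Qed.

Lemma cvg_nrm (x : H^nat) u :
  x n @[n --> \oo] --> u <-> nrm (x n - u) @[n --> \oo] --> (0 : R).
Proof.
split=> [/cvgrPdist_lt xu|/cvgrPdist_lt xu].
  apply/cvgrPdist_lt => e e0; have := xu e%:C; rewrite ltcR => /(_ e0).
  apply: filterS => n; rewrite normE ltcR sub0r normrN ger0_norm ?nrm_ge0//.
  by rewrite nrmBC.
(* A positive element of [R[i]] has imaginary part 0, so the tolerance is a real number. *)
apply/cvgrPdist_lt => -[e e']; rewrite ltcE /= => /andP[/eqP -> e0].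
have := xu _ e0; apply: filterS => n.
by rewrite normE -[_ +i* _]/(e%:C) ltcR sub0r normrN ger0_norm ?nrm_ge0// nrmBC.
Qed.

Lemma inner_sub u v u' v' :
  inner u v - inner u' v' =
  inner (u - u') (v - v') + inner (u - u') v' + inner u' (v - v').
Proof. by rewrite !(innerDl, innerDr, innerNl, innerNr); ring. Qed.

Lemma cvg_inner (x y : H^nat) u v :
  x n @[n --> \oo] --> u -> y n @[n --> \oo] --> v ->
  norm1 (inner (x n) (y n) - inner u v) @[n --> \oo] --> (0 : R).
Proof.
move=> /cvg_nrm xu /cvg_nrm yv.
pose b n := 2 * (nrm (x n - u) * nrm (y n - v)) + 2 * (nrm (x n - u) * nrm v) +
  2 * (nrm u * nrm (y n - v)).
have b0 : b n @[n --> \oo] --> (0 : R).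
  have -> : 0 = 2 * (0 * 0) + 2 * (0 * nrm v) + 2 * (nrm u * 0) :> R by ring.
  apply: cvgD; first apply: cvgD.
  - by apply: cvgMl_tmp; apply: cvgM.
  - by apply: cvgMl_tmp; apply: cvgMr_tmp.
  - by apply: cvgMl_tmp; apply: cvgMl_tmp.
apply: (squeeze_cvgr _ (cvg_cst 0) b0); apply: nearW => n.
rewrite norm1_ge0 /= inner_sub.
apply: (le_trans (norm1D _ _)); apply: lerD; last exact: norm1_inner.
by apply: (le_trans (norm1D _ _)); apply: lerD; exact: norm1_inner.
Qed.

End hilbert.

(** * Square-integrable functions *)

Section cintegral.
Context {R : realType}.
Local Notation mu := (@lebesgue_measure R).
Implicit Types (J : set R) (h : R -> R[i]) (a : R[i]).

Lemma cintegrableP J a h1 h2 : measurable J ->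
  cintegrable J h1 -> cintegrable J h2 ->
  cintegrable J (fun s => a * h1 s + h2 s).
Proof.
move=> mJ [r1 i1] [r2 i2]; case: a => a b; split.
  rewrite (_ : (fun _ => _) = (fun s => ((a%:E * (complex.Re (h1 s))%:E) +
      ((- b)%:E * (complex.Im (h1 s))%:E)) + (complex.Re (h2 s))%:E)%E).
    by apply: integrableD => //; apply: integrableD => //; exact: integrableZl.
  apply/funext => s; case: (h1 s) (h2 s) => [x y] [x' y'].
  by rewrite -!EFinM -!EFinD /=; congr EFin; ring.
rewrite (_ : (fun _ => _) = (fun s => ((a%:E * (complex.Im (h1 s))%:E) +
    (b%:E * (complex.Re (h1 s))%:E)) + (complex.Im (h2 s))%:E)%E).
  by apply: integrableD => //; apply: integrableD => //; exact: integrableZl.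
by apply/funext => s; case: (h1 s) (h2 s) => [x y] [x' y'].
Qed.

Lemma Rintegral_lin3 J (a b : R) (f g h : R -> R) : measurable J ->
  mu.-integrable J (EFin \o f) -> mu.-integrable J (EFin \o g) ->
  mu.-integrable J (EFin \o h) ->
  \int[mu]_(s in J) (a * f s + b * g s + h s) =
  a * \int[mu]_(s in J) f s + b * \int[mu]_(s in J) g s + \int[mu]_(s in J) h s.
Proof.
move=> mJ fi gi hi.
have ZE (c : R) (e : R -> R) : mu.-integrable J (EFin \o e) ->
    mu.-integrable J (EFin \o (fun s => c * e s)).
  by move=> ?; apply: (@integrableZl _ _ _ mu J mJ c (EFin \o e)).
rewrite (@RintegralD _ _ _ mu J (fun s => a * f s + b * g s) h)//; last first.
  exact: (@integrableD _ _ _ mu J mJ (EFin \o (fun s => a * f s))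
    (EFin \o (fun s => b * g s)) (ZE _ _ fi) (ZE _ _ gi)).
rewrite (@RintegralD _ _ _ mu J (fun s => a * f s) (fun s => b * g s))//; try exact: ZE.
by rewrite !RintegralZl.
Qed.

Lemma cintegralP J a h1 h2 : measurable J ->
  cintegrable J h1 -> cintegrable J h2 ->
  cintegral J (fun s => a * h1 s + h2 s) = a * cintegral J h1 + cintegral J h2.
Proof.
move=> mJ [r1 i1] [r2 i2]; case: a => a b; apply: (congr2 (@Complex R)).
  rewrite -mulNr -(Rintegral_lin3 _ _ mJ r1 i1 r2); congr Rintegral.
  by apply/funext => s; case: (h1 s) (h2 s) => [x y] [x' y'] /=; ring.
rewrite -(Rintegral_lin3 _ _ mJ i1 r1 i2); congr Rintegral.
by apply/funext => s; case: (h1 s) (h2 s) => [x y] [x' y'].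
Qed.

Lemma cintegrable_sum J n (c : 'I_n -> R[i]) (h : 'I_n -> R -> R[i]) :
  measurable J -> (forall i, cintegrable J (h i)) ->
  cintegrable J (fun s => \sum_i c i * h i s) /\
  cintegral J (fun s => \sum_i c i * h i s) = \sum_i c i * cintegral J (h i).
Proof.
move=> mJ hi; elim: n c h hi => [|n IH] c h hi.
  rewrite big_ord0 (_ : (fun _ => _) = fun=> 0); last first.
    by apply/funext => s; rewrite big_ord0.
  split; first by split; exact: integrable0.
  by rewrite /cintegral !Rintegral_cst//= mul0r.
have [ri rE] := IH (fun i => c (lift ord0 i)) _ (fun i => hi (lift ord0 i)).
rewrite (_ : (fun _ => _) = fun s => c ord0 * h ord0 s +
    \sum_i c (lift ord0 i) * h (lift ord0 i) s); last first.
  by apply/funext => s; rewrite big_ord_recl.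
by rewrite cintegralP// rE big_ord_recl; split => //; exact: cintegrableP.
Qed.

End cintegral.

Section L2_theory.
Context {R : realType} {k : hilbertType R}.
Local Notation mu := (@lebesgue_measure R).
Implicit Types (J : set R) (f g : R -> k).

(** The set is a finite union of joint level sets of [f] and [g], so [P] can be arbitrary and no
    sigma-algebra on [k] is involved. *)
Lemma simple_measurable2 f g (P : k -> k -> Prop) : simple_fun f -> simple_fun g ->
  measurable [set x | P (f x) (g x)].
Proof.
move=> [ff mf] [fg mg].
rewrite (_ : [set _ | _] = \bigcup_(p in (range f `*` range g) `&`
    [set p | P p.1 p.2]) (f @^-1` [set p.1] `&` g @^-1` [set p.2])).
  apply: fin_bigcup_measurable; last by move=> p _; exact: measurableI.
  by apply: finite_setIl; exact: finite_setX.
apply/seteqP; split=> [x Px|x [[a b] [_ /= Pab] [/= fa gb]]]; last by rewrite fa gb.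
by exists (f x, g x) => //; split => //; split; exists x.
Qed.

Lemma simple_fun2 (F : k -> k -> k) f g : simple_fun f -> simple_fun g ->
  simple_fun (fun x => F (f x) (g x)).
Proof.
move=> sf sg; split; last by move=> y; exact: (simple_measurable2 (fun a b => F a b = y)).
apply: (@sub_finite_set _ _ ((fun p => F p.1 p.2) @` (range f `*` range g))).
  by move=> _ [x _ <-]; exists (f x, g x) => //; split; exists x.
by apply: finite_image; apply: finite_setX; [case: sf|case: sg].
Qed.

Lemma simple_measurable_fun2 (F : k -> k -> R) f g J :
  simple_fun f -> simple_fun g -> measurable_fun J (fun x => F (f x) (g x)).
Proof.
move=> sf sg mJ Y mY; apply: measurableI => //.
exact: (simple_measurable2 (fun a b => Y (F a b))).
Qed.

Lemma simple_strongly_measurable J f : simple_fun f -> strongly_measurable J f.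
Proof. by move=> sf; exists (fun=> f); split => // x _; exact: cvg_cst. Qed.

Lemma strongly_measurableP J a f g : strongly_measurable J f ->
  strongly_measurable J g -> strongly_measurable J (fun x => a *: f x + g x).
Proof.
move=> [s [ss sf]] [t [st tg]]; exists (fun n x => a *: s n x + t n x); split.
  by move=> n; exact: (simple_fun2 (fun u v => a *: u + v)).
by move=> x Jx; apply: cvgD; [apply: cvgZl_tmp; exact: sf|exact: tg].
Qed.

Lemma cvg_norm1 (z : R[i]^nat) (w : R[i]) :
  norm1 (z n - w) @[n --> \oo] --> (0 : R) ->
  complex.Re (z n) @[n --> \oo] --> complex.Re w /\
  complex.Im (z n) @[n --> \oo] --> complex.Im w.
Proof.
move=> zw; split; apply/cvgrPdist_lt => e e0;
  move/cvgrPdist_lt: zw => /(_ e e0); apply: filterS => n;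
  rewrite sub0r normrN (ger0_norm (norm1_ge0 _)); apply: le_lt_trans;
  by case: (z n) w => [a b] [c d]; rewrite /norm1 /= distrC ?lerDl ?lerDr.
Qed.

Lemma inner_measurable J f g : measurable J -> strongly_measurable J f ->
  strongly_measurable J g -> cmeasurable J (fun x => inner (f x) (g x)).
Proof.
move=> mJ [s [ss sf]] [t [st tg]]; split.
  apply: (measurable_fun_cvg (h := fun n x => complex.Re (inner (s n x) (t n x)))).
    by move=> n; exact: (simple_measurable_fun2 (fun u v => complex.Re (inner u v))).
  by move=> x Jx; have [] := cvg_norm1 (cvg_inner (sf x Jx) (tg x Jx)).
apply: (measurable_fun_cvg (h := fun n x => complex.Im (inner (s n x) (t n x)))).
  by move=> n; exact: (simple_measurable_fun2 (fun u v => complex.Im (inner u v))).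
by move=> x Jx; have [] := cvg_norm1 (cvg_inner (sf x Jx) (tg x Jx)).
Qed.

Lemma L2_integrable J f : measurable J -> strongly_measurable J f ->
  L2 J f <-> mu.-integrable J (fun x => (nrm (f x) ^+ 2)%:E).
Proof.
move=> mJ sf; have [mr _] := inner_measurable mJ sf sf.
have -> : (fun x => (nrm (f x) ^+ 2)%:E) = (fun x => (complex.Re (inner (f x) (f x)))%:E).
  by apply/funext => x; rewrite sqr_nrm.
have -> : L2 J f = (\int[mu]_(s in J) (complex.Re (inner (f s) (f s)))%:E < +oo)%E :> Prop.
  by apply/propext; split => [[]//|? ]; split.
have aE : (\int[mu]_(s in J) `|(complex.Re (inner (f s) (f s)))%:E| =
    \int[mu]_(s in J) (complex.Re (inner (f s) (f s)))%:E)%E.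
  by apply: eq_integral => x _; rewrite gee0_abs// lee_fin -sqr_nrm sqr_ge0.
split=> [fi|/integrableP[_]]; last by rewrite aE.
by apply/integrableP; split; [exact/measurable_EFinP|rewrite aE].
Qed.

Lemma L2_inner J f g : measurable J -> L2 J f -> L2 J g ->
  cintegrable J (fun x => inner (f x) (g x)).
Proof.
move=> mJ /[dup] -[sf _] /(L2_integrable mJ sf) fi /[dup] -[sg _] /(L2_integrable mJ sg) gi.
have [mr mi] := inner_measurable mJ sf sg.
have fgi : mu.-integrable J (fun x => (2 * (nrm (f x) ^+ 2 + nrm (g x) ^+ 2))%:E).
  rewrite (_ : (fun _ => _) = (fun x => 2%:E * ((nrm (f x) ^+ 2)%:E + (nrm (g x) ^+ 2)%:E))%E).
    by apply: integrableZl => //; exact: integrableD.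
  by apply/funext => x; rewrite EFinM EFinD.
have le x : norm1 (inner (f x) (g x)) <= 2 * (nrm (f x) ^+ 2 + nrm (g x) ^+ 2).
  have := norm1_inner (f x) (g x).
  have := nrm_ge0 (f x); have := nrm_ge0 (g x); nra.
split.
  apply: le_integrable fgi => //; first exact/measurable_EFinP.
  move=> x _ /=; rewrite lee_fin [leRHS]ger0_norm ?mulr_ge0 ?addr_ge0 ?sqr_ge0//.
  by apply: le_trans (le x); rewrite lerDl.
apply: le_integrable fgi => //; first exact/measurable_EFinP.
move=> x _ /=; rewrite lee_fin [leRHS]ger0_norm ?mulr_ge0 ?addr_ge0 ?sqr_ge0//.
by apply: le_trans (le x); rewrite lerDr.
Qed.

(** The squared norm expands into four inner products, each integrable by [L2_inner]. *)
Lemma L2_lin J a f g : measurable J -> L2 J f -> L2 J g ->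
  L2 J (fun x => a *: f x + g x).
Proof.
move=> mJ Lf Lg; have sfg := strongly_measurableP a Lf.1 Lg.1.
apply/(L2_integrable mJ sfg).
rewrite (_ : (fun _ => _) = fun s => (complex.Re (
    a * (a^* * inner (f s) (f s) + inner (g s) (f s)) +
    (a^* * inner (f s) (g s) + inner (g s) (g s))))%:E); last first.
  apply/funext => s; rewrite sqr_nrm !(innerDr, innerDl, innerZr, innerZl).
  by congr (complex.Re _)%:E; ring.
by have [] := cintegrableP a mJ (cintegrableP a^* mJ (L2_inner mJ Lf Lf)
  (L2_inner mJ Lg Lf)) (cintegrableP a^* mJ (L2_inner mJ Lf Lg) (L2_inner mJ Lg Lg)).
Qed.

Lemma inner_L2P J a f g h : measurable J -> L2 J f -> L2 J g -> L2 J h ->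
  inner_L2 J h (fun x => a *: f x + g x) = a * inner_L2 J h f + inner_L2 J h g.
Proof.
move=> mJ Lf Lg Lh; rewrite /inner_L2 -cintegralP//; try exact: L2_inner.
by congr cintegral; apply/funext => x; rewrite innerDr innerZr.
Qed.

Lemma inner_L2_self J f :
  inner_L2 J f f = (\int[mu]_(x in J) nrm (f x) ^+ 2)%:C.
Proof.
apply/eqP; rewrite eq_complex /=; apply/andP; split; apply/eqP.
  by apply: eq_Rintegral => x _; rewrite sqr_nrm.
rewrite (eq_Rintegral _ (g := fun=> 0)) => [|x _]; last by rewrite innerE.
by rewrite /Rintegral integral0.
Qed.

End L2_theory.

(** * Density of step functions *)

Section indicators.
Context {R : realType} {k : hilbertType R}.
Implicit Types (A B : set R) (y : k) (s : R -> k).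

Definition restr A s : R -> k := fun x => if x \in A then s x else 0.

Lemma restr_simple A s : measurable A -> simple_fun s -> simple_fun (restr A s).
Proof.
move=> mA [fs ms]; split.
  apply: (@sub_finite_set _ _ (range s `|` [set 0])).
    by move=> _ [x _ <-]; rewrite /restr; case: ifP => _; [left; exists x|right].
  by rewrite finite_setU; split => //; exact: finite_set1.
move=> y.
rewrite (_ : _ @^-1` _ = (A `&` s @^-1` [set y]) `|` (~` A `&` [set x | 0 = y])).
  apply: measurableU; first exact: measurableI.
  apply: measurableI; first exact: measurableC.
  have [->|y0] := eqVneq y 0; first by rewrite (_ : [set _ | _] = setT)//; apply/seteqP.
  rewrite (_ : [set _ | _] = set0)//; apply/seteqP; split=> // x /= y0'.
  by move: y0; rewrite y0' eqxx.
apply/seteqP; split=> x; rewrite /restr /=; case: ifPn.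
- by rewrite inE => Ax sx; left.
- by rewrite notin_setE => Ax sx; right.
- by rewrite inE => Ax [[]|[]].
- by rewrite notin_setE => Ax [[]|[]].
Qed.

Lemma cst_simple y : simple_fun (fun=> y : k).
Proof.
split.
  apply: (@sub_finite_set _ _ [set y]); last exact: finite_set1.
  by move=> _ [x _ <-].
move=> z; have [->|yz] := pselect (y = z).
  by rewrite (_ : _ @^-1` _ = setT)//; apply/seteqP.
by rewrite (_ : _ @^-1` _ = set0)//; apply/seteqP; split=> // x.
Qed.

Lemma sqr_nrm_restr A y x :
  nrm (restr A (fun=> y) x) ^+ 2 = nrm y ^+ 2 * \1_A x.
Proof. by rewrite /restr indicE; case: ifP; rewrite ?mulr1 ?nrm0 ?expr0n ?mulr0. Qed.

End indicators.

Section density.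
Context {R : realType} {k : hilbertType R} (D : linspace k).
Context (D_dense : dense (subspace_set D)).
Local Notation mu := (@lebesgue_measure R).
Local Notation J := ([set` `[(0 : R), +oo[] : set R).
Context (F : fock k `[(0:R), +oo[).
Implicit Types f g : R -> k.

Lemma measurable_nneg : measurable J. Proof. exact: measurable_itv. Qed.
Hint Resolve measurable_nneg : core.

Local Notation Phi := (fpow F 1).

Lemma fpow1_inner f g : L2 J f -> L2 J g -> inner (Phi f) (Phi g) = inner_L2 J f g.
Proof. by move=> Lf Lg; rewrite fpow_inner. Qed.

(** Linearity is not part of the definition of [fock]; it follows from the inner products. The
    difference [w] of the two sides is orthogonal to every [Phi e], and is itself a combination of
    such vectors. *)
Lemma fpow1_lin a f g : L2 J f -> L2 J g ->
  Phi (fun x => a *: f x + g x) = a *: Phi f + Phi g.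
Proof.
move=> Lf Lg; have Lfg := L2_lin a measurable_nneg Lf Lg.
set h := fun x => _; apply/eqP; rewrite -subr_eq0; apply/eqP/inner_eq0.
set w := _ - _.
have hw e : L2 J e -> inner (Phi e) w = 0.
  move=> Le; rewrite innerDr innerNr innerDr innerZr !fpow1_inner//.
  by rewrite inner_L2P// subrr.
have wh e : L2 J e -> inner w (Phi e) = 0.
  by move=> Le; rewrite inner_conj hw// rmorph0.
by rewrite {2}/w innerDr innerNr innerDr innerZr !wh// mulr0 addr0 subrr.
Qed.

Lemma nrm_fpow1B f g : L2 J f -> L2 J g ->
  nrm (Phi f - Phi g) ^+ 2 = \int[mu]_(x in J) nrm (f x - g x) ^+ 2.
Proof.
move=> Lf Lg; have Lgf := L2_lin (-1) measurable_nneg Lg Lf.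
have -> : Phi f - Phi g = Phi (fun x => -1 *: g x + f x).
  by rewrite fpow1_lin// scaleN1r addrC.
rewrite sqr_nrm fpow1_inner// inner_L2_self; apply: eq_Rintegral => x _.
by rewrite scaleN1r addrC.
Qed.

(** By [nrm_fpow1B] the distance between images under [Phi] is the L^2 distance; the Fock space thus
    supplies the metric without a quotient of [L2]. *)
Definition approximable f : Prop := L2 J f /\
  forall e : R, 0 < e -> exists2 g, step_space D g & nrm (Phi f - Phi g) < e.

Lemma approximable_closed f : L2 J f ->
  (forall e : R, 0 < e -> exists2 g, approximable g & nrm (Phi f - Phi g) < e) ->
  approximable f.
Proof.
move=> Lf fP; split=> // e e0.
have e2 : 0 < e / 2 by rewrite divr_gt0.
have [g [_ gP] fg] := fP _ e2; have [h hD gh] := gP _ e2; exists h => //.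
rewrite -(subrKA (Phi g)); apply: (le_lt_trans (nrmD _ _)); lra.
Qed.

Lemma restr_L2 (A : set R) (N : R) y : measurable A -> A `<=` `[0, N[ ->
  L2 J (restr A (fun=> y : k)).
Proof.
move=> mA AN.
have sA : simple_fun (restr A (fun=> y)).
  by apply: restr_simple => //; exact: cst_simple.
apply/(L2_integrable _ (simple_strongly_measurable _ sA)) => //.
have iN : mu.-integrable J (fun x => ((nrm y ^+ 2)%:E * (\1_`[0, N[ x)%:E)%E).
  apply: integrableZl => //; apply: (integrableS measurableT) => //.
  exact: integrable_indic_itv.
apply: (le_integrable _ _ _ iN) => //.
  apply/measurable_EFinP; apply: (eq_measurable_fun (fun x => nrm y ^+ 2 * \1_A x)).
    by move=> x _; rewrite sqr_nrm_restr.
  by apply: measurable_funM => //; exact: measurable_indic.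
move=> x _; rewrite sqr_nrm_restr -EFinM lee_fin !ger0_norm ?mulr_ge0 ?sqr_ge0 ?nrm_ge0//.
apply: ler_wpM2l; first exact: sqr_ge0.
rewrite !indicE; have [xA|_] := boolP (x \in A); last by case: (_ \in _).
by rewrite mem_set//; apply/AN/set_mem.
Qed.

Lemma step_L2 f : step_space D f -> L2 J f.
Proof.
move=> [c [cP ->]]; elim: c cP => [|p c IH] cP.
  rewrite big_nil (_ : 0 = restr set0 (fun=> 0)); last first.
    by apply/funext => x; rewrite /restr in_set0.
  by apply: (@restr_L2 _ 0).
rewrite big_cons; apply: (L2_lin p.1 measurable_nneg); last first.
  by apply: IH => q qc; apply: cP; rewrite inE qc orbT.
have [d [s [_ s0 ->]]] := cP p (mem_head _ _).
rewrite (_ : (fun x => _) = restr `[0, s[ (fun=> d)); first by apply: (@restr_L2 _ s).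
by apply/funext => x; rewrite /restr mem_setE in_itv.
Qed.

Lemma approximable_step f : step_space D f -> approximable f.
Proof.
move=> fD; split; first exact: step_L2.
by move=> e e0; exists f => //; rewrite subrr nrm0.
Qed.

Lemma approximable_lin a f g : approximable f -> approximable g ->
  approximable (fun x => a *: f x + g x).
Proof.
move=> [Lf fP] [Lg gP]; split; first exact: L2_lin.
move=> e e0.
pose c := complex.Re `|a|.
have c0 : 0 <= c by have := normr_ge0 a; rewrite lecE => /andP[].
have e2 : 0 < e / 2 by rewrite divr_gt0.
have e2c : 0 < e / 2 / (c + 1) by rewrite divr_gt0 ?ltr_wpDl.
have [f' f'D ff'] := fP _ e2c; have [g' g'D gg'] := gP _ e2.
exists (a *: f' + g'); first exact: subspaceP.
rewrite !fpow1_lin//; try exact: step_L2.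
rewrite opprD addrACA -scalerBr; apply: (le_lt_trans (nrmD _ _)).
rewrite nrmZ_norm -/c.
have : c * nrm (Phi f - Phi f') <= e / 2.
  apply: (@le_trans _ _ ((c + 1) * (e / 2 / (c + 1)))).
    by apply: ler_pM => //; rewrite ?nrm_ge0 ?lerDl ?ltW.
  by rewrite mulrC divfK// gt_eqF// ltr_wpDl.
lra.
Qed.

Lemma approximable0 : approximable (fun=> 0).
Proof. by apply: approximable_step; exact: (subspace0 (step_space D)). Qed.

Lemma approximable_sum (T : Type) (r : seq T) (f : T -> R -> k) :
  (forall i, approximable (f i)) -> approximable (fun x => \sum_(i <- r) f i x).
Proof.
move=> fP; elim: r => [|i r IH].
  rewrite (_ : (fun _ => _) = fun=> 0); first exact: approximable0.
  by apply/funext => x; rewrite big_nil.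
rewrite (_ : (fun _ => _) = fun x => 1 *: f i x + \sum_(i <- r) f i x).
  exact: approximable_lin.
by apply/funext => x; rewrite big_cons scale1r.
Qed.

(** Dominated convergence in L^2: the squared distance between [f x] and [fn n x] tends to 0 and is
    at most [4 * b x ^+ 2]. *)
Lemma approximable_dominated (fn : nat -> R -> k) f (b : R -> R) :
  (forall n, approximable (fn n)) -> L2 J f ->
  (forall x, J x -> fn n x @[n --> \oo] --> f x) ->
  (forall n x, J x -> nrm (fn n x) <= b x) ->
  mu.-integrable J (fun x => (b x ^+ 2)%:E) ->
  approximable f.
Proof.
move=> fnP Lf fnf fnb bi; apply: approximable_closed => // e e0.
have Ld n : L2 J (fun x => -1 *: fn n x + f x).
  by apply: L2_lin => //; have [] := fnP n.
pose d n x := nrm (f x - fn n x) ^+ 2.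
have dE n : (fun x => (nrm (-1 *: fn n x + f x) ^+ 2)%:E) = EFin \o d n.
  by apply/funext => x; rewrite /= /d scaleN1r addrC.
have di n : mu.-integrable J (EFin \o d n).
  by rewrite -dE; apply/(L2_integrable _ (Ld n).1).
have fb x : J x -> nrm (f x) <= b x.
  move=> Jx; rewrite leNgt; apply/negP => bf.
  have /cvg_nrm /cvgrPdist_lt := fnf x Jx.
  have d0 : 0 < nrm (f x) - b x by rewrite subr_gt0.
  move=> /(_ _ d0) [N _ /(_ N (leqnn N))].
  rewrite sub0r normrN ger0_norm ?nrm_ge0// => dN.
  have := fnb N x Jx; have := nrmD (f x - fn N x) (fn N x).
  by rewrite subrK nrmBC; lra.
have : (\int[mu]_(x in J) (d n x)%:E)%E @[n --> \oo] --> (\int[mu]_(x in J) (cst 0 x))%E.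
  apply: (@dominated_cvg _ _ _ mu J measurable_nneg _ _ (fun x => (4%:E * (b x ^+ 2)%:E)%E)).
  - by move=> n; exact: (measurable_int mu (di n)).
  - move=> x Jx; apply/fine_cvgP; split; first exact: nearW.
    have /cvg_nrm c := fnf x Jx; have := cvgM c c; rewrite mulr0 => c2.
    rewrite (_ : fine \o _ = fun n => nrm (fn n x - f x) * nrm (fn n x - f x)).
      exact: c2.
    by apply/funext => n; rewrite /= /d nrmBC expr2.
  - by [].
  - exact: integrableZl.
  - move=> n x Jx; rewrite -EFinM lee_fin ger0_norm ?sqr_ge0//.
    have : nrm (f x - fn n x) <= 2 * b x.
      apply: (le_trans (nrmD _ _)); rewrite nrmN.
      by have := fb x Jx; have := fnb n x Jx; lra.
    by rewrite /d; have := nrm_ge0 (f x - fn n x); nra.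
rewrite integral0 => /fine_cvgP[_ /cvgrPdist_lt /(_ (e ^+ 2))].
rewrite exprn_gt0// => /(_ isT) [N _ /(_ N (leqnn N))] /=.
rewrite sub0r normrN => dN; exists (fn N) => //.
rewrite -(@ltr_pXn2r _ 2)// ?nnegrE ?nrm_ge0 ?(ltW e0)//.
rewrite nrm_fpow1B//; last by have [] := fnP N.
exact: (le_lt_trans (ler_norm _) dN).
Qed.

Lemma restr_itv_step d s : D d -> 0 <= s ->
  step_space D (restr `[0, s[ (fun=> d)).
Proof.
move=> Dd s0; apply: Lin_gen; exists d, s; split => //.
by apply/funext => x; rewrite /restr mem_setE in_itv.
Qed.

(** Here the density of [D] enters: replacing [y] by [d] in [D] costs [nrm (y - d) * Num.sqrt s].
    The tolerance is divided by [Num.sqrt s + 1], which is positive also for [s = 0]. *)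
Lemma restr_itv_approximable y s : 0 <= s ->
  approximable (restr `[0, s[ (fun=> y)).
Proof.
move=> s0; apply: approximable_closed; first exact: (@restr_L2 _ s).
move=> e e0.
have s1 : 0 < Num.sqrt s + 1 by rewrite ltr_wpDl ?sqrtr_ge0.
have [|d Dd yd] := @dense_nrm _ _ _ D_dense y (e / (Num.sqrt s + 1)).
  by rewrite divr_gt0.
exists (restr `[0, s[ (fun=> d)).
  by apply: approximable_step; exact: restr_itv_step.
rewrite -(@ltr_pXn2r _ 2)// ?nnegrE ?nrm_ge0 ?(ltW e0)//.
rewrite nrm_fpow1B; try exact: (@restr_L2 _ s).
rewrite (_ : \int[mu]_(x in J) _ =
    \int[mu]_(x in J) (nrm (y - d) ^+ 2 * \1_`[0, s[ x)); last first.
  apply: eq_Rintegral => x _; rewrite -sqr_nrm_restr /restr.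
  by case: ifP; rewrite ?subr0.
rewrite RintegralZl//; last first.
  apply: (integrableS measurableT) => //.
  exact: integrable_indic_itv.
have -> : \int[mu]_(x in J) \1_`[0, s[ x = s.
  rewrite /Rintegral integral_indic//= setIidl; last first.
    by move=> x /=; rewrite !in_itv /= => /andP[->].
  rewrite lebesgue_measure_itv/= lte_fin.
  by case: ltgtP s0 => // _ _; rewrite oppr0 adde0.
move: yd; rewrite ltr_pdivlMr// => yd.
apply: (@le_lt_trans _ _ ((nrm (y - d) * (Num.sqrt s + 1)) ^+ 2)).
  rewrite exprMn ler_wpM2l ?sqr_ge0// -[leLHS]sqr_sqrtr//.
  by rewrite lerXn2r ?nnegrE ?lerDl// ?addr_ge0 ?sqrtr_ge0.
by rewrite ltr_pXn2r ?nnegrE ?mulr_ge0 ?nrm_ge0 ?(ltW s1) ?(ltW e0).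
Qed.

(** A Dynkin argument: the sets [B] whose part in [[0, N[] has the property are stable under
    complements and countable disjoint unions, and include the rays [[a, +oo[], which generate the
    Borel sets and are closed under intersection. *)
Lemma restr_measurable_approximable (N : R) y (A : set R) : 0 <= N ->
  measurable A -> approximable (restr (A `&` `[0, N[) (fun=> y)).
Proof.
move=> N0.
have GE : @measurable _ (measurableTypeR R) = <<s @RGenCInfty.G R >>
  := RGenCInfty.measurableE R.
have mI (B : set R) : measurable B -> measurable (B `&` `[0, N[).
  by move=> mB; exact: measurableI.
have sI (B : set R) : B `&` `[0, N[ `<=` `[0, N[ by move=> x [].
have restrB (B C : set R) : B `<=` C -> restr (C `\` B) (fun=> y) =
    fun x => -1 *: restr B (fun=> y) x + restr C (fun=> y) x.
  move=> BC; apply/funext => x; rewrite /restr in_setD.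
  have [xB|xB] := boolP (x \in B); last by rewrite andbT scaler0 add0r.
  by rewrite (mem_set (BC _ (set_mem xB))) andbF scaleN1r addNr.
have PC (B : set R) : approximable (restr (B `&` `[0, N[) (fun=> y)) ->
    approximable (restr (~` B `&` `[0, N[) (fun=> y)).
  move=> PB; rewrite (_ : ~` B `&` _ = `[0, N[ `\` (B `&` `[0, N[)).
    rewrite restrB//; apply: approximable_lin => //.
    exact: restr_itv_approximable.
  by rewrite setIC setDIr setDv setU0 setDE.
have PT : approximable (restr (setT `&` `[0, N[) (fun=> y)).
  by rewrite setTI; exact: restr_itv_approximable.
rewrite -[measurable A]/((@measurable _ (measurableTypeR R)) A) GE.
apply: (dynkin_induction (P := fun B => approximable (restr (B `&` `[0, N[) (fun=> y))) GE) => //.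
- move=> _ _ [a ->] [b ->]; exists (Num.max a b).
  by apply/seteqP; split=> x /=; rewrite !in_itv /= !andbT ge_max => /andP.
(* The complement of the ray meets [[0, N[] in an interval starting at 0; the maximum with 0 makes
   it empty for negative [a]. *)
- move=> _ [a ->]; rewrite -(setCK (`[a, +oo[%classic : set R)); apply: PC.
  rewrite (_ : _ `&` _ = `[0, Num.max 0 (Num.min a N)[%classic).
    by apply: restr_itv_approximable; rewrite le_max lexx.
  apply/seteqP; split=> x /=; rewrite !in_itv /= andbT.
    by move=> [/negP]; rewrite -ltNge => xa /andP[x0 xN]; rewrite x0 lt_max lt_min xa xN orbT.
  move=> /andP[x0]; rewrite lt_max ltNge x0 /= lt_min => /andP[xa ->]; split => //.
  by apply/negP; rewrite -ltNge.
- by move=> B _; exact: PC.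
- move=> B mB tB PB; pose U n := \bigcup_(i in `I_n) B i.
  have PU n : approximable (restr (U n `&` `[0, N[) (fun=> y)).
    elim: n => [|n IH].
      rewrite (_ : restr _ _ = fun=> 0); first exact: approximable0.
      by apply/funext => x; rewrite /restr /U II0 bigcup_set0 set0I in_set0.
    rewrite (_ : restr _ _ = fun x => 1 *: restr (B n `&` `[0, N[) (fun=> y) x +
        restr (U n `&` `[0, N[) (fun=> y) x); first exact: approximable_lin.
    apply/funext => x; rewrite scale1r /restr /U IIS bigcup_setU bigcup_set1 setIUl in_setU orbC.
    have [xB|xB] := boolP (x \in B n `&` _); last by rewrite add0r.
    rewrite memNset ?addr0// => -[[i /= ni Bi] _].
    have := tB i n I I (ex_intro _ x (conj Bi (set_mem xB).1)).
    by move=> ie; rewrite ie ltnn in ni.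
  have mU : measurable (\bigcup_n B n) by exact: bigcup_measurable.
  apply: (@approximable_dominated (fun n => restr (U n `&` `[0, N[) (fun=> y)) _
    (fun x => nrm y * \1_`[0, N[ x)) => //.
  + by apply: (@restr_L2 _ N) => //; exact: mI.
  + move=> x Jx; have [[[i _ Bi] xN]|nx] := pselect ((\bigcup_n B n `&` `[0, N[) x).
      have xU n : (i < n)%N -> restr (U n `&` `[0, N[) (fun=> y) x = y.
        by move=> ni; rewrite /restr mem_set//; split => //; exists i.
      have -> : restr (\bigcup_n B n `&` `[0, N[) (fun=> y) x = y.
        by rewrite /restr mem_set//; split => //; exists i.
      apply: cvg_near_cst; exists i.+1 => // n /= ni; exact: xU.
    have -> : restr (\bigcup_n B n `&` `[0, N[) (fun=> y) x = 0.
      by rewrite /restr memNset.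
    apply: cvg_near_cst; apply: nearW => n; rewrite /restr memNset//.
    by move=> [[i ni Bi] xN]; apply: nx; split => //; exists i.
  + move=> n x Jx; rewrite /restr indicE.
    have [xU|] := boolP (_ \in _); last by rewrite nrm0 mulr_ge0// nrm_ge0.
    by rewrite (mem_set (set_mem xU).2) mulr1.
  + rewrite (_ : (fun _ => _) = fun x => ((nrm y ^+ 2)%:E * (\1_`[0, N[ x)%:E)%E).
      apply: integrableZl => //; apply: (integrableS measurableT) => //.
      exact: integrable_indic_itv.
    apply/funext => x; rewrite -EFinM exprMn; congr (_ * _)%:E.
    by rewrite indicE; case: (_ \in _); rewrite ?expr1n ?expr0n.
Qed.

Lemma simple_approximable (N : R) s : 0 <= N -> simple_fun s ->
  approximable (restr `[0, N[ s).
Proof.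
move=> N0 [/finite_seqP[r rE] ms].
rewrite (_ : restr _ _ = fun x => \sum_(y <- undup r)
    restr (s @^-1` [set y] `&` `[0, N[) (fun=> y) x).
  by apply: approximable_sum => y; exact: restr_measurable_approximable.
apply/funext => x; have xr : s x \in undup r.
  by rewrite mem_undup; have : range s (s x) by []; rewrite rE.
rewrite (bigD1_seq (s x))//= ?undup_uniq// big1 ?addr0; last first.
  by move=> y yx; rewrite /restr memNset// => -[/= xy _]; rewrite xy eqxx in yx.
rewrite /restr in_setI; congr (if _ then _ else _).
by rewrite [X in X && _]mem_set.
Qed.

(** The simple functions given by strong measurability need be neither dominated nor supported in a
    bounded interval. Truncating them in value and in support repairs both, and dominated
    convergence applies. *)
Lemma L2_approximable f : L2 J f -> approximable f.
Proof.
move=> Lf; have [[s [ss sf]] _] := Lf.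
have mf : measurable_fun J (fun x => nrm (f x)).
  apply: (measurable_fun_cvg (h := fun n x => nrm (s n x))).
    by move=> n; exact: (simple_measurable_fun2 (fun u v => nrm u) (ss n) (ss n)).
  move=> x Jx; apply/cvgrPdist_le => e e0.
  have /cvg_nrm /cvgrPdist_le /(_ e e0) := sf x Jx.
  apply: filterS => n; rewrite sub0r normrN ger0_norm ?nrm_ge0// => sn.
  rewrite ler_norml; apply/andP; split.
    have := nrmD (s n x - f x) (f x); rewrite subrK; lra.
  have := nrmD (f x - s n x) (s n x); rewrite subrK nrmBC; lra.
(* Truncating [s n] where it exceeds [2 * nrm f] makes it dominated without losing simplicity. *)
pose B n := J `&` [set x | nrm (s n x) <= 2 * nrm (f x)].
have mB n : measurable (B n).
  have -> : B n = J `&` (fun x => 2 * nrm (f x) - nrm (s n x)) @^-1` `[0, +oo[.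
    by congr setI; apply/seteqP; split=> x /=; rewrite in_itv /= andbT subr_ge0.
  have mg : measurable_fun J (fun x => 2 * nrm (f x) - nrm (s n x)).
    apply: measurable_funB; first exact: measurable_funM.
    exact: (simple_measurable_fun2 (fun u v => nrm u) (ss n) (ss n)).
  by apply: mg => //; exact: measurable_itv.
pose t n := restr `[0, n%:R[ (restr (B n) (s n)).
have tE n x : t n x = 0 \/ t n x = s n x /\ nrm (s n x) <= 2 * nrm (f x).
  rewrite /t /restr; case: ifP => _; last by left.
  by case: ifP => [/set_mem[]|]; [right|left].
apply: (@approximable_dominated t f (fun x => 2 * nrm (f x))) => //.
- by move=> n; apply: simple_approximable => //; exact: restr_simple.
(* Where [f x = 0] the truncation forces [t n x = 0]. Elsewhere [s n x] is eventually within
   [nrm (f x)] of [f x], so the cut-off no longer acts. *)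
- move=> x Jx; have [fx0|fx0] := eqVneq (f x) 0.
    apply: cvg_near_cst; apply: nearW => n; rewrite fx0.
    by case: (tE n x) => // -[-> ]; rewrite fx0 nrm0 mulr0 => sn;
      apply/nrm_eq0/le_anti; rewrite sn nrm_ge0.
  apply/cvg_nrm/cvgrPdist_lt => e e0.
  have /cvg_nrm /cvgrPdist_lt se := sf x Jx.
  have f0 : 0 < nrm (f x).
    by rewrite lt_neqAle nrm_ge0 andbT eq_sym; apply: contra_neq fx0; exact: nrm_eq0.
  near=> n; rewrite sub0r normrN ger0_norm ?nrm_ge0//.
  suff -> : t n x = s n x.
    rewrite -[ltLHS]ger0_norm ?nrm_ge0// -normrN -sub0r; near: n; exact: se.
  rewrite /t /restr mem_set; last first.
    move: Jx; rewrite /= !in_itv /= andbT => ->/=.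
    near: n; exact: nbhs_infty_gtr.
  rewrite mem_set//; split => //=.
  have : nrm (s n x - f x) < nrm (f x).
    rewrite -[ltLHS]ger0_norm ?nrm_ge0// -normrN -sub0r; near: n; exact: se.
  have := nrmD (s n x - f x) (f x); rewrite subrK; lra.
- move=> n x Jx; case: (tE n x) => [->|[-> //]].
  by rewrite nrm0 mulr_ge0// nrm_ge0.
- rewrite (_ : (fun _ => _) = fun x => (4%:E * (nrm (f x) ^+ 2)%:E)%E).
    by apply: integrableZl => //; apply/(L2_integrable _ Lf.1).
  by apply/funext => x; rewrite -EFinM exprMn; congr (_ * _)%:E; ring.
Unshelve. all: by end_near.
Qed.

End density.

(** * Totality of exponential vectors *)

Section exponential_vectors.
Context {R : realType} {k : hilbertType R}.
Local Notation mu := (@lebesgue_measure R).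
Local Notation J := ([set` `[(0 : R), +oo[] : set R).
Context (F : fock k `[(0:R), +oo[).
Implicit Types f g : R -> k.
Hint Resolve measurable_nneg : core.

(* [^*] parses as [Num.conj] inside the operands of ring operations and as [conjc] elsewhere. *)
Lemma conjcR (t : R) : Num.conj (t%:C) = t%:C.
Proof. exact: conjc_real. Qed.

Definition expv_coeff n : R := (Num.sqrt (n`!%:R : R))^-1.

Definition expv_term f n : F := (expv_coeff n)%:C *: fpow F n f.

Definition sqL2 f : R := \int[mu]_(x in J) nrm (f x) ^+ 2.

Lemma sqL2_ge0 f : 0 <= sqL2 f.
Proof. by apply: Rintegral_ge0 => x _; exact: sqr_ge0. Qed.

Lemma expv_term_inner f m n : L2 J f -> inner (expv_term f m) (expv_term f n) =
  if m == n then (exp_coeff (sqL2 f) n)%:C else 0.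
Proof.
move=> Lf; rewrite innerZl innerZr fpow_inner//; case: eqP => [->|_]; last first.
  by rewrite !mulr0.
rewrite inner_L2_self conjcR -rmorphXn -!rmorphM /= /exp_coeff /=; congr (_%:C).
have n0 : 0 <= n`!%:R :> R by [].
by rewrite /expv_coeff mulrA -invfM -expr2 sqr_sqrtr// mulrC.
Qed.

(** Terms of different degrees are orthogonal, so Pythagoras reduces everything to the scalar
    exponential series at [sqL2 f]. *)
Lemma nrm_expv_sum f m n : L2 J f ->
  nrm (\sum_(m <= i < n) expv_term f i) ^+ 2 =
  \sum_(m <= i < n) exp_coeff (sqL2 f) i.
Proof.
move=> Lf; elim: n => [|n IH]; first by rewrite !big_geq// nrm0 expr0n.
have [mn|nm] := leqP m n; last by rewrite !big_geq// nrm0 expr0n.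
rewrite !big_nat_recr//= sqr_nrmD IH [inner _ _]inner_conj inner_sumr.
have -> : \sum_(m <= i < n) inner (expv_term f n) (expv_term f i) = 0.
  by rewrite big_nat big1// => i /andP[_ ni]; rewrite expv_term_inner// gtn_eqF.
by rewrite conjc0 mulr0 addr0 [in LHS]sqr_nrm expv_term_inner// eqxx.
Qed.

(** The limit in [expv] would be a default value if the series diverged; the Cauchy criterion is
    inherited from the scalar exponential series. *)
Lemma expv_cvg f : L2 J f ->
  \sum_(0 <= i < n) expv_term f i @[n --> \oo] --> expv F f.
Proof.
move=> Lf; apply: (@cauchy_cvg F); apply/cauchy_seriesP => -[e e'].
rewrite ltcE /= => /andP[/eqP -> e0].
have /cvg_cauchy /cauchy_seriesP /(_ (e ^+ 2)) := is_cvg_series_exp_coeff (sqL2 f).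
rewrite exprn_gt0// => /(_ isT); apply: filterS => -[m n] /= le.
rewrite normE -[_ +i* _]/(e%:C) ltcR.
rewrite -(@ltr_pXn2r _ 2)// ?nnegrE ?nrm_ge0 ?(ltW e0)// nrm_expv_sum//.
exact: le_lt_trans (ler_norm _) le.
Qed.

Lemma sum_exp_coeff_le (x : R) n : 0 <= x -> \sum_(0 <= i < n) exp_coeff x i <= expR x.
Proof.
move=> x0; apply: (nondecreasing_cvgn_le _ (is_cvg_series_exp_coeff x)).
apply/nondecreasing_seqP => m; rewrite /series /= big_nat_recr//= lerDl.
exact: exp_coeff_ge0.
Qed.

Lemma L2Z (t : R[i]) f : L2 J f -> L2 J (t *: f).
Proof.
move=> Lf; rewrite (_ : t *: f = fun x => (t - 1) *: f x + f x); first exact: L2_lin.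
by apply/funext => x; rewrite scalerBl scale1r subrK.
Qed.

Lemma inner_L2Z (t : R[i]) f g : L2 J f -> L2 J g ->
  inner_L2 J g (t *: f) = t * inner_L2 J g f.
Proof.
move=> Lf Lg; rewrite (_ : t *: f = fun x => (t - 1) *: f x + f x).
  by rewrite inner_L2P// mulrBl mul1r subrK.
by apply/funext => x; rewrite scalerBl scale1r subrK.
Qed.

(** As with [fpow1_lin], homogeneity comes from the inner products: the squared norm of the
    difference expands to 0. *)
Lemma fpowZ n (t : R) f : L2 J f ->
  fpow F n (t%:C *: f) = (t ^+ n)%:C *: fpow F n f.
Proof.
move=> Lf; have Ltf := L2Z t%:C Lf.
apply/eqP; rewrite -subr_eq0; apply/eqP/inner_eq0.
have E1 : inner_L2 J f (t%:C *: f) = t%:C * inner_L2 J f f by rewrite inner_L2Z.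
have E2 : inner_L2 J (t%:C *: f) f = t%:C * inner_L2 J f f.
  have := fpow1_inner F Ltf Lf; rewrite inner_conj fpow1_inner// E1 => <-.
  by rewrite inner_L2_self -rmorphM conjc_real.
have E3 : inner_L2 J (t%:C *: f) (t%:C *: f) = t%:C * (t%:C * inner_L2 J f f).
  by rewrite inner_L2Z// E2.
rewrite !(innerDl, innerDr, innerNl, innerNr, innerZl, innerZr) !fpow_inner// !eqxx.
rewrite E1 E2 E3 conjcR rmorphXn /= !exprMn; ring.
Qed.

Lemma expv_termZ n (t : R) f : L2 J f ->
  expv_term (t%:C *: f) n = (t ^+ n)%:C *: expv_term f n.
Proof. by move=> Lf; rewrite /expv_term fpowZ// !scalerA mulrC. Qed.

Lemma sqL2Z (t : R) f : L2 J f -> sqL2 (t%:C *: f) = t ^+ 2 * sqL2 f.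
Proof.
move=> Lf; apply: complexI; rewrite -inner_L2_self.
have := fpow_inner F 1 1 (L2Z t%:C Lf) (L2Z t%:C Lf); rewrite eqxx expr1 => <-.
rewrite fpowZ// innerZl innerZr fpow_inner// eqxx inner_L2_self.
by rewrite conjcR !expr1 rmorphM /= rmorphXn /=; ring.
Qed.

(** For [t] in [[0, 1]] each squared term of degree [i >= n] carries a factor at most
    [(t ^+ n) ^+ 2], and what remains is bounded by [expR (sqL2 f)]. *)
Lemma expv_tail n (t : R) f : L2 J f -> 0 <= t <= 1 ->
  nrm (expv F (t%:C *: f) - \sum_(0 <= i < n) expv_term (t%:C *: f) i) <=
  t ^+ n * Num.sqrt (expR (sqL2 f)).
Proof.
move=> Lf /andP[t0 t1]; have Ltf := L2Z t%:C Lf.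
set x := expv _ _; set s := fun n => \sum_(0 <= i < n) expv_term (t%:C *: f) i.
rewrite -/(s n); set K := Num.sqrt _.
have sK m : (n <= m)%N -> nrm (s m - s n) <= t ^+ n * K.
  move=> nm; rewrite -(@ler_pXn2r _ 2)// ?nnegrE ?nrm_ge0 ?mulr_ge0 ?exprn_ge0 ?sqrtr_ge0//.
  rewrite /s (big_cat_nat (leq0n n) nm)/= [X in nrm X]addrAC subrr add0r nrm_expv_sum// sqL2Z//.
  rewrite exprMn sqr_sqrtr ?expR_ge0//.
  apply: (@le_trans _ _ ((t ^+ n) ^+ 2 * \sum_(n <= i < m) exp_coeff (sqL2 f) i)).
    rewrite mulr_sumr !big_nat; apply: ler_sum => i /andP[ni _].
    rewrite /exp_coeff /= exprMn mulrA ler_wpM2r ?invr_ge0//.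
    rewrite ler_wpM2r ?exprn_ge0 ?sqL2_ge0// -!exprM mulnC.
    by rewrite ler_wiXn2l// leq_mul2r ni orbT.
  rewrite ler_wpM2l ?sqr_ge0//.
  apply: le_trans (sum_exp_coeff_le m (sqL2_ge0 f)).
  rewrite (big_cat_nat (leq0n n) nm)/= lerDr; apply: sumr_ge0 => i _.
  by rewrite exp_coeff_ge0// sqL2_ge0.
(* The bound [sK] passes to the limit: otherwise some late partial sum would be closer to [x] than
   the excess over the bound. *)
rewrite leNgt; apply/negP => lt.
have /cvg_nrm /cvgrPdist_lt := expv_cvg Ltf.
move=> /(_ (nrm (x - s n) - t ^+ n * K)); rewrite subr_gt0 lt => /(_ isT) [N _ NP].
have := NP (maxn N n) (leq_maxl _ _).
rewrite /= sub0r normrN ger0_norm ?nrm_ge0// -/(s _) -/x nrmBC.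
have := nrmD (x - s (maxn N n)) (s (maxn N n) - s n).
rewrite subrKA; have := sK (maxn N n) (leq_maxr _ _); lra.
Qed.

Lemma fpow_orthogonal (x : F) f : L2 J f ->
  (forall t : R, inner (expv F (t%:C *: f)) x = 0) ->
  forall n, inner (fpow F n f) x = 0.
Proof.
move=> Lf fx.
suff tx n : inner (expv_term f n) x = 0.
  move=> n; have := tx n; rewrite innerZl => /eqP; rewrite mulf_eq0 => /orP[|/eqP//].
  rewrite conjcR -(rmorph0 (real_complex R)) (inj_eq (@complexI R)) invr_eq0.
  by rewrite gt_eqF// sqrtr_gt0 ltr0n fact_gt0.
elim/ltn_ind: n => n IH.
(* The [n]-th coefficient is [O(t)], as the terms beyond it are [O(t ^+ n.+1)]; take [t] dyadic. *)
set K := Num.sqrt (expR (sqL2 f)).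
apply/norm1_le0/(@le0_pow2 _ _ (2 * (K * nrm x))) => m.
set t : R := (2 ^+ m)^-1.
have t0 : 0 < t by rewrite invr_gt0 exprn_gt0.
have t1 : t <= 1 by rewrite invf_le1 ?exprn_gt0// exprn_ege1// ler1n.
have tail := @expv_tail n.+1 t f Lf; rewrite (ltW t0) t1 in tail.
have {tail} := tail isT; rewrite -/K.
set r := _ - _ => rK.
(* The full exponential vector is orthogonal to [x] by [fx], and the terms below [n] by induction;
   only degree [n] survives. *)
have rE : inner r x = - ((t ^+ n)%:C * inner (expv_term f n) x).
  rewrite innerDl fx add0r innerNl; congr (- _).
  rewrite [LHS]inner_conj inner_sumr big_nat_recr//= big_nat big1.
    rewrite add0r -inner_conj expv_termZ// innerZl conjcR.
  by [].
  move=> i /andP[_ ni]; rewrite expv_termZ// innerZr [inner x _]inner_conj.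
  by rewrite IH// conjc0 mulr0.
have := norm1_inner r x; rewrite rE.
have -> : norm1 (- ((t ^+ n)%:C * inner (expv_term f n) x)) =
    t ^+ n * norm1 (inner (expv_term f n) x).
  have tn : 0 <= t ^+ n by rewrite exprn_ge0 ?ltW.
  case: (inner (expv_term f n) x) => a b; rewrite /norm1 /= !mul0r subr0 addr0.
  by rewrite !normrN !normrM ger0_norm// mulrDr.
move=> le; rewrite -(@ler_pM2l _ (t ^+ n)) ?exprn_gt0//.
apply: (le_trans le).
have -> : t ^+ n * (2 * (K * nrm x) / 2 ^+ m) = 2 * (t ^+ n.+1 * K * nrm x).
  by rewrite -/t exprS; ring.
by rewrite ler_wpM2l// ler_wpM2r// nrm_ge0.
Qed.

Lemma cvg_norm1X (z : nat -> R[i]) (w : R[i]) n :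
  norm1 (z m - w) @[m --> \oo] --> (0 : R) ->
  norm1 (z m ^+ n - w ^+ n) @[m --> \oo] --> (0 : R).
Proof.
move=> zw; elim: n => [|n IH].
  rewrite (_ : (fun _ => _) = fun=> 0); first exact: cvg_cst.
  by apply/funext => m; rewrite !expr0 subrr norm1_0.
pose b m := norm1 (z m ^+ n - w ^+ n) * norm1 (z m - w) +
  norm1 (w ^+ n) * norm1 (z m - w) + norm1 (z m ^+ n - w ^+ n) * norm1 w.
have b0 : b m @[m --> \oo] --> (0 : R).
  have -> : 0 = 0 * 0 + norm1 (w ^+ n) * 0 + 0 * norm1 w :> R by ring.
  apply: cvgD; first apply: cvgD.
  - exact: cvgM.
  - exact: cvgMl_tmp.
  - exact: cvgMr_tmp.
apply: (squeeze_cvgr _ (cvg_cst 0) b0); apply: nearW => m; rewrite norm1_ge0 /=.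
have -> : z m ^+ n.+1 - w ^+ n.+1 = (z m ^+ n - w ^+ n) * (z m - w) +
  w ^+ n * (z m - w) + (z m ^+ n - w ^+ n) * w by rewrite !exprS; ring.
apply: (le_trans (norm1D _ _)); apply: lerD; last exact: norm1M.
by apply: (le_trans (norm1D _ _)); apply: lerD; exact: norm1M.
Qed.

Lemma norm1N (z : R[i]) : norm1 (- z) = norm1 z.
Proof. by case: z => a b; rewrite /norm1 /= !normrN. Qed.

(** The squared distance of the [n]-th powers is a signed sum of [n]-th powers of four inner
    products in degree 1. All four tend to the same limit [w], and the signs cancel. *)
Lemma cvg_fpow n (g : nat -> R -> k) f : L2 J f -> (forall m, L2 J (g m)) ->
  fpow F 1 (g m) @[m --> \oo] --> fpow F 1 f ->
  fpow F n (g m) @[m --> \oo] --> fpow F n f.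
Proof.
move=> Lf Lg gf; have ff : (fun _ : nat => fpow F 1 f) @ \oo --> fpow F 1 f by exact: cvg_cst.
have c1 := cvg_norm1X n (cvg_inner gf gf); have c2 := cvg_norm1X n (cvg_inner gf ff).
have c3 := cvg_norm1X n (cvg_inner ff gf); apply/cvg_nrm.
have c : nrm (fpow F n (g m) - fpow F n f) ^+ 2 @[m --> \oo] --> (0 : R).
  pose b m := let w := inner (fpow F 1 f) (fpow F 1 f) ^+ n in
    norm1 (inner (fpow F 1 (g m)) (fpow F 1 (g m)) ^+ n - w) +
    norm1 (inner (fpow F 1 (g m)) (fpow F 1 f) ^+ n - w) +
    norm1 (inner (fpow F 1 f) (fpow F 1 (g m)) ^+ n - w).
  have b0 : b m @[m --> \oo] --> (0 : R).
    rewrite -[0](addr0 0) -[X in _ --> X + _](addr0 0).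
    exact: cvgD (cvgD c1 c2) c3.
  apply: (squeeze_cvgr _ (cvg_cst 0) b0); apply: nearW => m; rewrite /b /=.
  rewrite sqr_ge0 /= sqr_nrm !(innerDl, innerDr, innerNl, innerNr) !fpow1_inner//.
  rewrite !fpow_inner// !eqxx.
  move: (inner_L2 _ f f ^+ n) (inner_L2 _ (g m) (g m) ^+ n) => w a.
  move: (inner_L2 _ (g m) f ^+ n) (inner_L2 _ f (g m) ^+ n) => p q.
  rewrite (_ : complex.Re _ = complex.Re ((a - w) - (p - w) - (q - w))).
    apply: le_trans (ler_norm _) _; apply: (@le_trans _ _ (norm1 ((a - w) - (p - w) - (q - w)))).
      by rewrite lerDl.
    rewrite (le_trans (norm1D _ _))// norm1N lerD2r.
    by rewrite (le_trans (norm1D _ _))// norm1N.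
  congr complex.Re; ring.
apply/cvgrPdist_lt => e e0; move/cvgrPdist_lt: c => /(_ (e ^+ 2)).
rewrite exprn_gt0// => /(_ isT); apply: filterS => m.
rewrite !sub0r !normrN !ger0_norm ?sqr_ge0 ?nrm_ge0//.
by rewrite ltr_pXn2r// ?nnegrE ?nrm_ge0// ltW.
Qed.

Lemma expv_total (D : linspace k) : dense (subspace_set D) ->
  forall x : F, (forall f, step_space D f -> inner (expv F f) x = 0) -> x = 0.
Proof.
move=> D_dense x xP.
have fx f n : L2 J f -> inner (fpow F n f) x = 0.
  move=> Lf; have [_ fP] := L2_approximable D_dense F Lf.
  have /choice[g gP] m : exists g, step_space D g /\
      nrm (fpow F 1 f - fpow F 1 g) < m.+1%:R^-1.
    by have [|g gD gf] := fP m.+1%:R^-1; [rewrite invr_gt0|exists g].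
  have Lg m : L2 J (g m) by apply: step_L2; exact: (gP m).1.
  have gf : fpow F 1 (g m) @[m --> \oo] --> fpow F 1 f.
    apply/cvg_nrm; apply: (squeeze_cvgr _ (cvg_cst 0) (@cvg_harmonic R)).
    by apply: nearW => m; rewrite nrm_ge0 nrmBC ltW// (gP m).2.
  have xx : (fun _ : nat => x) @ \oo --> x by exact: cvg_cst.
  have [re im] := cvg_norm1 (cvg_inner (cvg_fpow (n := n) Lf Lg gf) xx).
  have gx m : inner (fpow F n (g m)) x = 0.
    apply: fpow_orthogonal => // t; apply: xP.
    rewrite -[_ *: _]addr0; apply: subspaceP; first exact: (gP m).1.
    exact: subspace0.
  move: re im; under eq_fun do rewrite gx; move=> re.
  under eq_fun do rewrite gx; move=> im.
  have := cvg_unique _ re (cvg_cst _); have := cvg_unique _ im (cvg_cst _).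
  case: (inner _ _) => a b /= -> // -> //.
(* If [nrm x > 0], totality yields a combination [v] of vectors [fpow n f] closer to [x] than
   [nrm x]. As [v] is orthogonal to [x], this contradicts Cauchy-Schwarz. *)
apply: nrm_eq0; apply/le_anti; rewrite nrm_ge0 andbT leNgt; apply/negP => x0.
have [v [s [sP vE]] xv] := dense_nrm (@fpow_total _ _ _ F) x x0.
have vx : inner v x = 0.
  rewrite inner_conj vE inner_sumr big1_seq ?conjc0// => p /andP[_ ps].
  have [n [f [Lf ->]]] := sP p ps.
  by rewrite innerZr inner_conj fx// conjc0 mulr0.
have : nrm x ^+ 2 <= nrm (x - v) * nrm x.
  rewrite sqr_nrm -[inner x x]subr0 -[X in _ - X]vx -innerNl -innerDl.
  exact: le_trans (ler_norm _) (Re_inner_le _ _).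
by rewrite expr2 ler_pM2r// leNgt xv.
Qed.

End exponential_vectors.

(** * Uniqueness *)

Lemma step_simple (R : realType) (k : hilbertType R) (D : linspace k) (f : R -> k) :
  step_space D f -> simple_fun f.
Proof.
move=> [c [cP ->]]; elim: c cP => [|p c IH] cP.
  by rewrite big_nil; exact: cst_simple.
rewrite big_cons; apply: (simple_fun2 (fun u v => p.1 *: u + v)); last first.
  by apply: IH => q qc; apply: cP; rewrite inE qc orbT.
have [d [s [_ s0 ->]]] := cP p (mem_head _ _).
rewrite (_ : (fun x => _) = restr `[0, s[ (fun=> d)).
  by apply: restr_simple => //; exact: cst_simple.
by apply/funext => x; rewrite /restr mem_setE in_itv.
Qed.

(** One preimage is selected for each value of [h]. Any function evaluated at [rho s] then takes
    finitely many values, hence is bounded. *)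
Lemma finite_range_section (T U : Type) (h : T -> U) : T -> finite_set (range h) ->
  exists rho : T -> T, finite_set (range rho) /\ forall s, h (rho s) = h s.
Proof.
move=> t0 fh.
have /choice[tau tauP] y : exists s, range h y -> h s = y.
  by have [[s _ <-]|ny] := pselect (range h y); [exists s|exists t0].
exists (tau \o h); split; last by move=> s; apply: tauP; exists s.
by rewrite -(image_comp h tau); exact: finite_image.
Qed.

Lemma finite_range_bound (R : realType) (T : Type) (rho : T -> R) (N : R -> R) :
  finite_set (range rho) -> (forall s, 0 <= N s) ->
  exists M, forall s, N (rho s) <= M.
Proof.
move=> /finite_seqP[r rE] N0; exists (\sum_(s <- r) N s) => s.
have : rho s \in r by have : range rho (rho s) by []; rewrite rE.
move=> /perm_to_rem /(perm_big _) ->; rewrite big_cons lerDl.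
exact: sumr_ge0.
Qed.

Section uniqueness.
Context {R : realType} {k : hilbertType R} (D : linspace k) (F : fock_family k).
Context (C : coalgType R[i]) (phi : {linear C -> Ops (Dhat D)}).
Local Notation Fock := (F `[0, +oo[).
Local Notation ED := (E_D D F).
Local Notation eps f := (exp_vec F `[0, +oo[ f).

Lemma eq_Ops_exp (A B : Ops ED) :
  (forall g : steps D, opfun A (eps g) = opfun B (eps g)) -> A = B.
Proof.
move=> AB; apply: val_inj; apply/funext => xi.
(* A predicate on the ambient space, with the membership proof quantified, so that [Lin_min] can be
   applied. *)
pose P : set Fock := [set v | exists Ev : (ED : set Fock) v,
  opfun A (in_subspace Ev) = opfun B (in_subspace Ev)].
have P0 : P 0.
  exists (subspace0 ED).
  rewrite (_ : in_subspace _ = 0); last exact: val_inj.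
  have lin0 (Z : Ops ED) : opfun Z 0 = 0.
    have Zl := set_mem (subvec_valP Z).
    have : opfun Z 0 = 1 *: opfun Z 0 + opfun Z 0.
      by rewrite -[in RHS]Zl scaler0 addr0.
    by rewrite scale1r => /eqP; rewrite -subr_eq subrr => /eqP.
  by rewrite !lin0.
have PP a u v : P u -> P v -> P (a *: u + v).
  move=> [Eu uAB] [Ev vAB]; exists (subspaceP a Eu Ev).
  rewrite (_ : in_subspace _ = a *: in_subspace Eu + in_subspace Ev); last exact: val_inj.
  have linP (Z : Ops ED) : opfun Z (a *: in_subspace Eu + in_subspace Ev) =
      a *: opfun Z (in_subspace Eu) + opfun Z (in_subspace Ev).
    exact: (set_mem (subvec_valP Z)).
  by rewrite !linP uAB vAB.
have /Lin_min : [set x | exists2 f, step_space D f & x = expv Fock f] `<=` Linspace P0 PP.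
  move=> _ [f fD ->].
  exists (Lin_gen (ex_intro2 _ _ f fD erefl)).
  have := AB (in_subspace fD).
  by rewrite (_ : eps (in_subspace fD) = in_subspace (Lin_gen (ex_intro2 _ _ f fD erefl)))//;
    exact: val_inj.
move=> /(_ _ (set_mem (subvec_valP xi))) [Exi].
by rewrite (_ : in_subspace Exi = xi)//; exact: val_inj.
Qed.

Variables X Y : coalg_process D F C.
Variables f g : steps D.

(** The functional u_s of the overview; [symbol s] below is psi_s. *)
Definition matrix_diff (s : R) (c : C) : R[i]^o :=
  inner (expv Fock f) (opfun (X c s) (eps g) - opfun (Y c s) (eps g)).

Lemma matrix_diff_linear s : linear (matrix_diff s).
Proof.
move=> a u v; rewrite /matrix_diff.
have E (Z : coalg_process D F C) : opfun (Z (a *: u + v) s) (eps g) =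
  a *: opfun (Z u s) (eps g) + opfun (Z v s) (eps g) by rewrite linearP.
by rewrite !E opprD addrACA -scalerBr innerDr innerZr.
Qed.

Definition symbol (s : R) (c : C) : R[i]^o :=
  inner_hat (hat (f s)) (opfun (phi c) (hat_step g s)).

Lemma symbol_linear s : linear (symbol s).
Proof.
move=> a u v; rewrite /symbol.
have -> : opfun (phi (a *: u + v)) (hat_step g s) =
  a *: opfun (phi u) (hat_step g s) + opfun (phi v) (hat_step g s) by rewrite linearP.
rewrite /inner_hat /= inner_linear mulrDr addrACA; congr (_ + _).
rewrite -[_ *: (opfun (phi u) _).1]/(_ * _) mulrCA.
by rewrite -[_ *: (_ : R[i]^o)]/(_ * _) -[_ *: _]/(_ * _) -mulrDr.
Qed.

HB.instance Definition _ s :=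
  GRing.isLinear.Build R[i] C R[i]^o *:%R (matrix_diff s) (matrix_diff_linear s).
HB.instance Definition _ s :=
  GRing.isLinear.Build R[i] C R[i]^o *:%R (symbol s) (symbol_linear s).

(** Subtracting the two equations cancels the counit terms; the integrand is a convolution because
    [qsde_fun] is a product of a functional of [a1] and one of [a2]. *)
Lemma matrix_diffE (c : C) t :
  weak_solution phi X -> weak_solution phi Y -> 0 <= t ->
  cintegrable `[0, t] (fun s => conv (matrix_diff s) (symbol s) c) /\
  matrix_diff t c = cintegral `[0, t] (fun s => conv (matrix_diff s) (symbol s) c).
Proof.
move=> /(_ f g t c) WX /(_ f g t c) WY t0.
have {WX}[iX eX] := WX t0; have {WY}[iY eY] := WY t0.
have mt : measurable (`[0, t]%classic : set R) by exact: measurable_itv.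
set hX := (fun s => tensor_eval (comul c) (qsde_form phi X f g s)) in iX eX.
set hY := (fun s => tensor_eval (comul c) (qsde_form phi Y f g s)) in iY eY.
have hE : (fun s => conv (matrix_diff s) (symbol s) c) = fun s => -1 * hY s + hX s.
  apply/funext => s; rewrite /conv /= /convolution.
  apply: tensor_eval_lin => u v /=.
  rewrite /matrix_diff /symbol /qsde_fun innerDr innerNr mulrC mulrDr addrC.
  by rewrite mulrN -scaleN1r.
clearbody hX hY; rewrite hE; split; first exact: cintegrableP mt iY iX.
rewrite (cintegralP _ mt iY iX) -eX -eY /matrix_diff.
have E (Z : coalg_process D F C) :
    opfun (Z c t - counit c *: idop ED) (eps g) =
    opfun (Z c t) (eps g) - counit c *: (subvec_val (eps g)) by [].
by rewrite !E !(innerDr, innerNr); ring.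
Qed.

Lemma matrix_diff_eq0 (c : C) t :
  weak_solution phi X -> weak_solution phi Y -> 0 <= t -> matrix_diff t c = 0.
Proof.
move=> WX WY t0.
have [n [la laP]] := conv_finite c.
have [m [u [v cE]]] := tensor_repr (comul c).
(* [rho] replaces times by finitely many representatives with the same values of [f] and [g]. *)
have [rho [frho rhoE]] : exists rho : R -> R, finite_set (range rho) /\
    forall s, (fun s => (f s, g s)) (rho s) = (f s, g s).
  apply: finite_range_section => //.
  have ff := (step_simple (set_mem (subvec_valP f))).1.
  have fg := (step_simple (set_mem (subvec_valP g))).1.
  apply: sub_finite_set (finite_setX ff fg).
  by move=> _ [s _ <-]; split; exists s.
have symbolE s d : symbol (rho s) d = symbol s d.
  have [fs gs] := rhoE s; rewrite /symbol fs; congr (inner_hat _ (opfun _ _)).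
  by apply: val_inj; rewrite /= gs.
(* Choice gives no control over the dependence of the coefficients on time; they are therefore used
   only at times [rho s], which yields the bound [M]. *)
have /choice[x xP] (ps : 'I_n * R) : exists x : 'I_n -> R[i],
    forall mu : {linear C -> R[i]^o}, conv mu (conv (symbol ps.2) (la ps.1)) c =
      \sum_q x q * conv mu (la q) c by exact: laP.
have [M MP] := finite_range_bound frho
  (N := fun s => \sum_pq norm1 (x (pq.1, s) pq.2))
  (fun s => sumr_ge0 _ (fun pq _ => norm1_ge0 _)).
have conv_rho s p d : conv (symbol (rho s)) (la p) d = conv (symbol s) (la p) d.
  have [l [u' [v' dE]]] := tensor_repr (comul d).
  rewrite (convE (symbol (rho s)) _ dE) (convE (symbol s) _ dE).
  by apply: eq_bigr => i _; congr (_ * _); exact: symbolE.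
have convE' mu s p : conv mu (conv (symbol s) (la p)) c =
    \sum_q x (p, rho s) q * conv mu (la q) c.
  rewrite -(xP (p, rho s) mu) (convE mu _ cE) (convE mu (conv (symbol (rho s)) _) cE).
  by apply: eq_bigr => i _; rewrite conv_rho.
(* By associativity the integrand for [la p] is a fixed finite combination of the integrands of the
   weak equations at the [u i], so integrability and the integral equation carry over. *)
have convsE p : (fun s => conv (matrix_diff s) (conv (symbol s) (la p)) c) =
    fun s => \sum_i la p (v i) * conv (matrix_diff s) (symbol s) (u i).
  apply/funext => s; rewrite -convA (convE _ _ cE); apply: eq_bigr => i _.
  by rewrite mulrC.
have v0 p s : 0 <= s -> conv (matrix_diff s) (la p) c = 0.
  move: p s; apply: (gronwall (h := fun p s => conv (matrix_diff s) (conv (symbol s) (la p)) c)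
    (c := fun p q s => x (p, rho s) q) (M := M)).
  - move=> p s s0.
    rewrite convsE.
    apply: (cintegrable_sum _ _ _).1 => // i.
    by have [] := matrix_diffE (u i) WX WY s0.
  - move=> p s s0.
    rewrite convsE.
    rewrite (cintegrable_sum _ _ _).2 => // [|i]; last first.
      by have [] := matrix_diffE (u i) WX WY s0.
    rewrite (convE _ _ cE); apply: eq_bigr => i _.
    by have [_ <-] := matrix_diffE (u i) WX WY s0; rewrite mulrC.
  - by move=> p s s0; rewrite convE'.
  - move=> p q s _; apply: le_trans (MP s).
    by rewrite (bigD1 (p, q))//= lerDl; apply: sumr_ge0 => *; exact: norm1_ge0.
(* Since [counit] is the unit of convolution, expanding it along the [la p] recovers
   [matrix_diff t c] from the vanishing functions. *)
have [y yE] := laP counit.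
rewrite -[LHS](conv_counit (matrix_diff t)) yE big1// => p _.
by rewrite v0// mulr0.
Qed.

End uniqueness.

Theorem proposition3p3p2 (R : realType) (k : hilbertType R) (D : linspace k)
    (D_dense : dense (subspace_set D)) (F : fock_family k) (C : coalgType R[i])
    (phi : {linear C -> Ops (Dhat D)}) (X Y : coalg_process D F C) :
  weak_solution phi X -> weak_solution phi Y ->
  forall (a : C) (t : R), 0 <= t -> X a t = Y a t.
Proof.
(* The operators are compared on exponential vectors of [g], and the difference of the images is
   tested against exponential vectors of [f]. *)
move=> WX WY a t t0; apply: eq_Ops_exp => g; apply/eqP; rewrite -subr_eq0; apply/eqP.
apply: (expv_total D_dense) => f fD.
exact: (@matrix_diff_eq0 _ _ _ _ _ phi X Y (in_subspace fD) g).
Qed.
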